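(* Let $(u_k)_{k\ge1}$ be an entropy-balanced random process (with $h(\mathbf u_n)$ finite), and let $G$ be a causal LTI filter with transfer function $G(z)=\sum_{k=0}^{\eta}g_kz^{-k}$ (impulse response of length $\eta+1$, not identically zero). For each $n$ let $\mathbf y_{n+\eta}:=\breve{\mathbf G}_n\mathbf u_n\in\mathbb R^{n+\eta}$ be the entire output of $G$ (zero initial state) to the input $u_1,\dots,u_n$, where $\breve{\mathbf G}_n\in\mathbb R^{(n+\eta)\times n}$ has entries $[\breve{\mathbf G}_n]_{i,j}=g_{i-j}$ for $i\ge j$ (with $g_k=0$ for $k>\eta$) and $0$ for $i<j$. Then $$\lim_{n\to\infty}\frac1n\big(\breve h(\mathbf y_{n+\eta})-\breve h(\mathbf u_n)\big)=\frac1{2\pi}\int_{-\pi}^{\pi}\log|G(e^{j\omega})|\,d\omega.$$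
   Context: Notation: $\mathbf v_n:=(v_1,\dots,v_n)^T$; $h$ is differential entropy. Entropy balanced: a process $(v_k)$ is entropy balanced if for every $\nu\in\mathbb N$ and every sequence $(\Phi_n)_{n>\nu}$, $\Phi_n\in\mathbb R^{(n-\nu)\times n}$ with orthonormal rows, $\lim_{n\to\infty}\frac1n(h(\Phi_n\mathbf v_n)-h(\mathbf v_n))=0$. Effective differential entropy: if a random vector $\mathbf y\in\mathbb R^\ell$ can be written as $\mathbf y=\mathbf S\mathbf u$ with $\mathbf u\in\mathbb R^n$, $n\le\ell$, and $\mathbf S\in\mathbb R^{\ell\times n}$ of full column rank, with (thin) SVD $\mathbf S=\mathbf A^T\mathbf T\mathbf C$ where $\mathbf A\in\mathbb R^{n\times\ell}$ has orthonormal rows, $\mathbf T\in\mathbb R^{n\times n}$ is diagonal and $\mathbf C\in\mathbb R^{n\times n}$ is orthogonal, then $\breve h(\mathbf y):=h(\mathbf A\mathbf y)$. (In particular $\breve h(\mathbf u_n)=h(\mathbf u_n)$.) *)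

(* Defs.v *)
From HB Require Import structures.
From mathcomp Require Import all_boot all_order all_algebra all_classical all_reals all_analysis.

Set Implicit Arguments.
Unset Strict Implicit.
Unset Printing Implicit Defensive.

Import Order.TTheory GRing.Theory Num.Theory.
Local Open Scope classical_set_scope.
Local Open Scope ring_scope.

(* R^n (column vectors) equipped with its Borel sigma-algebra, i.e.     *)
(* the sigma-algebra generated by the half-open boxes prod_i ]a_i,b_i]. *)
Definition vecR (R : realType) (n : nat) := 'cV[R]_n.
HB.instance Definition _ (R : realType) n := Choice.on (vecR R n).
HB.instance Definition _ (R : realType) n := isPointed.Build (vecR R n) 0.

Definition boxes (R : realType) (n : nat) : set (set (vecR R n)) :=
  [set B | exists a b : 'I_n -> R,
           B = [set v : vecR R n | forall i, a i < v i 0 <= b i]].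

Definition Rvec (R : realType) (n : nat) := g_sigma_algebraType (@boxes R n).

(* n-dimensional Lebesgue integral of a (nonnegative, extended-real)   *)
(* function, as the iterated one-dimensional Lebesgue integral         *)
(* (Tonelli): int dx_0 int dx_1 ... int dx_{n-1} F(x_0,...,x_{n-1}).    *)
Fixpoint iint (R : realType) (n : nat) (F : seq R -> \bar R) : \bar R :=
  match n with
  | 0 => F [::]
  | k.+1 => (\int[@lebesgue_measure R]_x iint k (fun s => F (x :: s)))%E
  end.

Definition vint (R : realType) (n : nat) (F : 'cV[R]_n -> \bar R) : \bar R :=
  iint n (fun s => F (\col_(i < n) nth 0 s i)).

Definition is_density (R : realType) (d : measure_display) (T : measurableType d)
  (P : probability T R) (n : nat) (X : T -> 'cV[R]_n) (f : Rvec R n -> R) : Prop :=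
  [/\ measurable_fun setT f,
      (forall v, 0 <= f v) &
      forall A : set (Rvec R n), measurable A ->
        P (X @^-1` A) = vint (fun v => (\1_A v * f v)%:E)].

(* h = - int f log f  =  int (f log f)^-  -  int (f log f)^+  *)
Definition entropy_of_density (R : realType) (n : nat) (f : Rvec R n -> R)
  : \bar R :=
  (vint (fun v => (Num.max (- (f v * ln (f v))) 0)%:E)
   - vint (fun v => (Num.max (f v * ln (f v)) 0)%:E))%E.

(* differential entropy h(X); -oo when X has no density *)
Definition diff_entropy (R : realType) (d : measure_display) (T : measurableType d)
  (P : probability T R) (n : nat) (X : T -> 'cV[R]_n) : \bar R :=
  match pselect (exists f, is_density P X f) with
  | left H => entropy_of_density (proj1_sig (cid H))
  | right _ => (-oo)%E
  end.

Definition thin_svd (R : realType) (l n : nat) (S : 'M[R]_(l, n))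
  (A : 'M[R]_(n, l)) (Tm : 'M[R]_n) (C : 'M[R]_n) : Prop :=
  [/\ S = A^T *m Tm *m C,
      A *m A^T = 1%:M,
      is_diag_mx Tm,
      (forall i, 0 < Tm i i) &
      C *m C^T = 1%:M /\ C^T *m C = 1%:M].

(* breve h(y) := h(A y), for y = S u with S = A^T T C a thin SVD of S   *)
(* (S must have full column rank; -oo otherwise).                     *)
Definition eff_entropy (R : realType) (d : measure_display) (T : measurableType d)
  (P : probability T R) (l n : nat) (S : 'M[R]_(l, n)) (y : T -> 'cV[R]_l)
  : \bar R :=
  match pselect (exists ATC : 'M[R]_(n, l) * 'M[R]_n * 'M[R]_n,
                   thin_svd S ATC.1.1 ATC.1.2 ATC.2) with
  | left H => diff_entropy P (fun w => (proj1_sig (cid H)).1.1 *m y w)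
  | right _ => (-oo)%E
  end.

(* The process (v_k)_{k>=1} is represented by v : nat -> T -> R with    *)
(* v_k := v (k-1), so bold v_n = (v 0, ..., v (n-1))^T.                 *)
Definition vecn (R : realType) (T : Type) (v : nat -> T -> R) (n : nat)
  : T -> 'cV[R]_n := fun w => \col_(i < n) v i w.

Definition entropy_balanced (R : realType) (d : measure_display)
  (T : measurableType d) (P : probability T R) (v : nat -> T -> R) : Prop :=
  forall nu : nat, (0 < nu)%N ->
  forall Phi : forall n : nat, 'M[R]_((n - nu)%N, n),
    (forall n : nat, (nu < n)%N -> Phi n *m (Phi n)^T = 1%:M) ->
    (fun n : nat =>
       ((diff_entropy P (fun w => Phi n *m vecn v n w)
         - diff_entropy P (vecn v n)) * (n%:R^-1)%:E)%E) @ \oo --> 0%E.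

Definition gcoef (R : realType) (g : nat -> R) (eta k : nat) : R :=
  if (k <= eta)%N then g k else 0.

Definition Gmat (R : realType) (g : nat -> R) (eta n : nat) : 'M[R]_(n + eta, n) :=
  \matrix_(i < n + eta, j < n) if (j <= i)%N then gcoef g eta (i - j) else 0.

(* |G(e^{j w})| = | sum_k g_k e^{-j k w} | *)
Definition Gmag (R : realType) (g : nat -> R) (eta : nat) (w : R) : R :=
  Num.sqrt ((\sum_(k < eta.+1) g k * cos (k%:R * w)) ^+ 2
            + (\sum_(k < eta.+1) g k * sin (k%:R * w)) ^+ 2).

(* Main.v *)
Require Import Defs.
From HB Require Import structures.
From mathcomp Require Import all_boot all_order all_algebra all_classical all_reals all_analysis.
From mathcomp Require Import measurable_realfun complex spectral sesquilinear.
From mathcomp Require Import ring lra zify.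
Import Order.TTheory GRing.Theory Num.Theory.
Import numFieldNormedType.Exports.
Local Open Scope classical_set_scope.
Local Open Scope ring_scope.

Set Implicit Arguments.
Unset Strict Implicit.
Unset Printing Implicit Defensive.

(* If S = A^T T C is a thin SVD of the convolution matrix S = Gmat g eta n, then
   A y = T C u, so the linear change of variables in R^n gives
   h(A y) - h(u) = ln |det (T C)| = (1/2) ln det (S^T S), and everything reduces to
   the growth of det (S^T S).  Factor G = c prod (X - a) over the complex numbers.
   Replacing the factors X - a with |a| < 1 by 1 - conj(a) X does not change the
   Gram matrix S^* S, and turns G into q0 prod (1 - b X) with all |b| <= 1 and
   |q0| = |c| prod max(1, |a|).  The top square block U of the new S is triangular
   with det U = q0^n, and its inverse has entries of polynomial size in n, whence
   |q0|^(2n) <= det (S^* S) <= |q0|^(2n) poly(n).  By Jensen's formula ln |q0| is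
   the mean of ln |G| on the unit circle; the formula for one factor follows from
   |e^{2iw} - a^2| = |e^{iw} - a| |e^{iw} + a|, by which the mean of ln |e^{iw} - a|
   doubles when a is squared although it stays bounded. *)

(** * Lebesgue integration on R^n and linear changes of variables *)

Section affine_change.
Context {R : realType}.
Local Notation mu := (@lebesgue_measure R).
Local Open Scope ereal_scope.

(** The reflection is forced by the inverse of the triangular block: expanded around 0, 1/(X - a)
    has coefficients growing like |a|^(-k), so roots inside the disc would make its entries
    exponential in n. Once all |b| <= 1, write S as U stacked on a block V of only eta rows and put
    X = V U^-1. With ^H for the conjugate transpose, S^H S = U^H (1 + X^H X) U, and det (1 + X^H X)
    = det (1 + X X^H) is a determinant of the fixed size eta. The matrix 1 + X X^H has eigenvalues
    at least 1, which gives the lower bound; its polynomial entries give a polynomial upper bound,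
    invisible after ln and division by n. In Jensen's formula the obstacle is that ln |e^{iw} - a|
    is unbounded for |a| = 1, so the doubling argument has a uniform bound only for |a| < 1; the
    circle is reached by Fatou's lemma and the outside by inversion. On the entropy side, [vint] is
    a mere iterated integral: a measure on R^n with these integrals has to be produced before
    densities can be compared almost everywhere. *)

Lemma measurable_affine (a b : R) : measurable_fun setT (fun x : R => a * x + b)%R.
Proof. by apply: measurable_funD => //; exact: mulrl_measurable. Qed.

(** Lebesgue measure is determined by its values on half-open intervals, and the scaled image
    measure gives each of them its length. A negative slope turns the interval around, hence two
    cases. *)
Lemma lebesgue_measure_affine (a b : R) (A : set R) : a != 0%R ->
  measurable A ->
  `|a|%:E * mu ((fun x => a * x + b)%R @^-1` A) = mu A.
Proof.
move=> a0 mA.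
have mf : measurable_fun setT
    (fun x : measurableTypeR R => (a * x + b)%R : measurableTypeR R).
  exact: measurable_affine.
have na0 : (0 <= `|a|)%R by [].
pose m : measure (measurableTypeR R) R := mscale (NngNum na0)
  (measure_function_pushforward__canonical__measure_function_Measure mu mf).
have mE X : m X = `|a|%:E * mu ((fun x => a * x + b)%R @^-1` X) by [].
rewrite -mE; apply/esym; apply: lebesgue_measure_unique => // X.
move=> /ocitvP[->|[[x y] /= xy ->]]; first by rewrite !measure0.
rewrite mE.
have [a_lt0|a_gt0|/eqP] := ltgtP a 0%R; last by rewrite (negbTE a0).
- rewrite (_ : _ @^-1` _ = `[(y - b) / a, (x - b) / a[%classic)%R; last first.
    apply/seteqP; split => z/=; rewrite !in_itv/= ler_ndivrMr// ltr_ndivlMr//.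
      by move=> /andP[? ?]; apply/andP; split; lra.
    by move=> /andP[? ?]; apply/andP; split; lra.
  rewrite !lebesgue_measure_itv/= !lte_fin xy ltr_nM2r ?invr_lt0// ltrD2r xy.
  by rewrite -!EFinB -EFinM ltr0_norm//; congr EFin; field.
- rewrite (_ : _ @^-1` _ = `](x - b) / a, (y - b) / a]%classic)%R; last first.
    apply/seteqP; split => z/=; rewrite !in_itv/= ler_pdivlMr// ltr_pdivrMr//.
      by move=> /andP[? ?]; apply/andP; split; lra.
    by move=> /andP[? ?]; apply/andP; split; lra.
  rewrite !lebesgue_measure_itv/= !lte_fin xy ltr_pM2r ?invr_gt0// ltrD2r xy.
  by rewrite -!EFinB -EFinM gtr0_norm//; congr EFin; field.
Qed.

Lemma ge0_integral_affine (a b : R) (f : R -> \bar R) : a != 0%R ->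
  measurable_fun setT f -> (forall x, 0 <= f x) ->
  `|a|%:E * \int[mu]_x f (a * x + b)%R = \int[mu]_x f x.
Proof.
move=> a0 mf f0.
have mg : measurable_fun setT
    (fun x : measurableTypeR R => (a * x + b)%R : measurableTypeR R).
  exact: measurable_affine.
have na0 : (0 <= `|a|)%R by [].
rewrite -(ge0_integral_pushforward mg mu measurableT)//.
pose m : measure (measurableTypeR R) R :=
  measure_function_pushforward__canonical__measure_function_Measure mu mg.
rewrite -[LHS](ge0_integral_mscale m measurableT (NngNum na0))//.
apply: eq_measure_integral => A mA _.
exact: lebesgue_measure_affine.
Qed.
End affine_change.

(** * Measurability of coordinates, matrix maps and the head-tail splitting *)

Section vectors.
Context {R : realType}.
Implicit Types n : nat.

(** The generators are bounded boxes, so a slab in one coordinate is exhausted by boxes whose other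
    sides are ]-k, k]. *)
Lemma measurable_coord n (i : 'I_n) :
  measurable_fun setT (fun v : Rvec R n => v i 0).
Proof.
apply: (@measurability _ _ _ (measurableTypeR R) _ _ (@ocitv R)) => //.
move=> _ [_ /ocitvP[->|[[a b] /= ab ->]] <-]; first by rewrite preimage_set0 setI0.
rewrite setTI (_ : _ @^-1` _ = \bigcup_k [set v : vecR R n |
   forall j, (if j == i then a else - k%:R) < v j 0 <= (if j == i then b else k%:R)]).
  apply: bigcupT_measurable => k; apply: sub_sigma_algebra.
  by exists (fun j => if j == i then a else - k%:R), (fun j => if j == i then b else k%:R).
apply/seteqP; split => [v /=|v [k _ /(_ i)]]; rewrite ?in_itv/= ?eqxx//.
move=> vi; pose M := \sum_j `|v j 0|.
have [k Mk] : exists k, M < k%:R.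
  by exists (Num.bound M); rewrite archi_boundP// sumr_ge0.
exists k => // j; case: eqP => [->//|_].
have : `|v j 0| < k%:R.
  apply: le_lt_trans Mk; rewrite /M (bigD1 j)//= lerDl; exact: sumr_ge0.
by rewrite ltr_norml => /andP[-> /ltW ->].
Qed.

Lemma measurable_vecP d (T : measurableType d) n (f : T -> Rvec R n) :
  (forall i, measurable_fun setT (fun t => f t i 0)) -> measurable_fun setT f.
Proof.
move=> mf; apply: (@measurability _ _ _ (Rvec R n) _ _ (@boxes R n)) => //.
move=> _ [_ [a [b ->]] <-]; rewrite setTI.
rewrite (_ : _ @^-1` _ = \bigcap_(i : 'I_n) ((fun t => f t i 0) @^-1` `]a i, b i]%classic)).
  apply: fin_bigcap_measurable => [|i _]; first exact: finite_finset.
  by rewrite -[_ @^-1` _]setTI; exact: mf.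
by apply/seteqP; split => [t /= h i _|t h i /=]; move: (h i); rewrite /= in_itv/= => // ->.
Qed.

Lemma measurable_mulmx m n (M : 'M[R]_(m, n)) :
  measurable_fun setT (fun v : Rvec R n => M *m v : Rvec R m).
Proof.
apply: measurable_vecP => i; under eq_fun do rewrite mxE.
apply: measurable_sum => j; apply: measurable_funM => //.
exact: measurable_coord.
Qed.

Lemma measurable_addmx n (w : 'cV[R]_n) :
  measurable_fun setT (fun v : Rvec R n => v + w : Rvec R n).
Proof.
apply: measurable_vecP => i; under eq_fun do rewrite mxE.
by apply: measurable_funD => //; exact: measurable_coord.
Qed.

(** The identification of R x R^n with R^(n+1) that matches the recursion of [iint], which
    integrates the head outermost. *)
Definition consv n (p : measurableTypeR R * Rvec R n) : Rvec R n.+1 := col_mx p.1%:M p.2.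

Lemma measurable_consv n : measurable_fun setT (@consv n).
Proof.
apply: measurable_vecP => i; rewrite /consv.
have [j ->|j ->] := @split_ordP 1 n i.
  under eq_fun do rewrite (@col_mxEu _ 1 n) mxE ord1 eqxx mulr1n.
  exact: measurable_fst.
under eq_fun do rewrite (@col_mxEd _ 1 n).
by apply: (measurableT_comp (measurable_coord j)).
Qed.

Lemma vintS n (F : 'cV[R]_n.+1 -> \bar R) :
  vint F = (\int[@lebesgue_measure R]_x vint (fun v => F (consv (x, v))))%E.
Proof.
rewrite /vint/=; apply: eq_integral => x _; congr iint; apply/funext => s.
congr F; apply/colP => i; rewrite mxE /consv.
have [j ->|j ->] := @split_ordP 1 n i.
  by rewrite (@col_mxEu _ 1 n) !ord1 mxE eqxx mulr1n.
by rewrite (@col_mxEd _ 1 n) mxE.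
Qed.

End vectors.

(** * A sigma-finite measure behind the iterated integral *)

Section lebn.
Context {R : realType}.
Implicit Types n : nat.
Local Notation leb := (@lebesgue_measure R).
Local Open Scope ereal_scope.

Definition unconsv n (w : Rvec R n.+1) : measurableTypeR R * Rvec R n :=
  (w 0%R 0%R, @dsubmx R 1 n 1 w).

Lemma unconsvK n : cancel (@unconsv n) (@consv R n).
Proof.
move=> w; rewrite /consv/unconsv/=; apply/colP => i.
have [j ->|j ->] := @split_ordP 1 n i.
  rewrite (@col_mxEu _ 1 n) mxE !ord1 eqxx mulr1n.
  by congr (w _ _); apply/val_inj.
by rewrite (@col_mxEd _ 1 n) mxE.
Qed.

Lemma consvK n : cancel (@consv R n) (@unconsv n).
Proof.
move=> [x v]; rewrite /consv/unconsv/=; congr pair; last by rewrite (@col_mxKd _ 1 n).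
rewrite [X in @fun_of_matrix _ _ _ _ X](_ : _ = @lshift 1 n 0%R); last exact/val_inj.
by rewrite (@col_mxEu _ 1 n) mxE eqxx mulr1n.
Qed.

Lemma measurable_unconsv n : measurable_fun setT (@unconsv n).
Proof.
apply: measurable_fun_pair; first exact: measurable_coord.
apply: measurable_vecP => i; under eq_fun do rewrite mxE.
exact: measurable_coord.
Qed.

(** Two increasing exhaustions F and G need only diagonal rectangles: a point of F i x G j lies in
    the one of index max i j. *)
Lemma sigma_finite_prod d1 d2 (T1 : measurableType d1) (T2 : measurableType d2)
  (m1 : {sigma_finite_measure set T1 -> \bar R})
  (m2 : {sigma_finite_measure set T2 -> \bar R}) : sigma_finite setT (m1 \x m2).
Proof.
have /sigma_finiteP[F [TF ndF Ffin]] := sigma_finiteT m1.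
have /sigma_finiteP[G [TG ndG Gfin]] := sigma_finiteT m2.
exists (fun k => F k `*` G k).
  rewrite -setXTT TF TG; apply/seteqP; split=> [[x y] [/= [i _ Fx] [j _ Gy]]|[x y]].
    exists (maxn i j) => //; split.
    - by move: x Fx; exact/subsetPset/ndF/leq_maxl.
    - by move: y Gy; exact/subsetPset/ndG/leq_maxr.
  by move=> [k _ [/= ? ?]]; split; exists k.
move=> k; have [? ?] := Ffin k; have [? ?] := Gfin k.
split; first exact: measurableX.
by rewrite product_measure1E// lte_mul_pinfty// ge0_fin_numE.
Qed.

(** Built by recursion: the Dirac mass on the one-point space R^0, then the image under [consv] of
    the product with Lebesgue measure; Tonelli turns its integral back into the iterated one.
    Sigma-finiteness is carried along because the next application of Tonelli requires it. *)
Lemma vint_measure n : exists m : {sigma_finite_measure set (Rvec R n) -> \bar R},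
  forall F : Rvec R n -> \bar R, measurable_fun setT F -> (forall v, 0 <= F v) ->
  vint F = \int[m]_v F v.
Proof.
elim: n => [|n [m mE]].
  exists (dirac (0%R : Rvec R 0)) => F mF F0.
  rewrite integral_dirac// diracT mul1e /vint/=; congr F.
  by apply/colP => -[].
pose lm : measure (measurableTypeR R * Rvec R n)%type R := leb \x m.
pose p : measure (Rvec R n.+1) R :=
  measure_function_pushforward__canonical__measure_function_Measure
    lm (@measurable_consv R n).
have psf : sigma_finite setT p.
  have [F FT Ffin] := sigma_finite_prod leb m.
  exists (fun k => @unconsv n @^-1` F k).
    by rewrite -preimage_bigcup -FT preimage_setT.
  move=> k; have [mF Fk] := Ffin k; split.
    by rewrite -[_ @^-1` _]setTI; exact: measurable_unconsv.
  rewrite /p/= /pushforward -comp_preimage (_ : _ \o _ = id) ?preimage_id//.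
  by apply/funext => x /=; rewrite consvK.
pose p' : {sigma_finite_measure set (Rvec R n.+1) -> \bar R} :=
  HB.pack (p : set _ -> _) (Measure.class p) (Measure_isSigmaFinite.Build _ _ _ p psf).
exists p' => F mF F0.
rewrite vintS.
have -> : \int[p']_v F v = \int[leb \x m]_z (F \o @consv R n) z.
  have := @ge0_integral_pushforward _ _ _ _ R _ (@measurable_consv R n) lm
    setT F measurableT mF (fun v _ => F0 v).
  by rewrite preimage_setT.
rewrite fubini_tonelli1; last 2 first.
- by apply: (measurableT_comp mF); exact: measurable_consv.
- by move=> x; exact: F0.
apply: eq_integral => x _; rewrite mE//.
apply: (measurableT_comp mF); apply: (measurableT_comp (@measurable_consv R n)).
exact: measurable_pair1.
Qed.

End lebn.

(** * The change of variables formula for invertible matrices *)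

Section linear_change.
Context {R : realType}.
Implicit Types n : nat.
Local Notation leb := (@lebesgue_measure R).
Local Open Scope ereal_scope.

Definition lebn n : {sigma_finite_measure set (Rvec R n) -> \bar R} :=
  proj1_sig (cid (@vint_measure R n)).

Lemma vintE n (F : Rvec R n -> \bar R) :
  measurable_fun setT F -> (forall v, 0 <= F v) -> vint F = \int[lebn n]_v F v.
Proof. exact: proj2_sig (cid (@vint_measure R n)) F. Qed.

Lemma measurable_consv_pair n (F : Rvec R n.+1 -> \bar R) :
  measurable_fun setT F -> measurable_fun setT (F \o @consv R n).
Proof. by move=> mF; apply: (measurableT_comp mF); exact: measurable_consv. Qed.

Lemma measurable_consvr n (F : Rvec R n.+1 -> \bar R) x :
  measurable_fun setT F -> measurable_fun setT (fun v => F (consv (x, v))).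
Proof.
move=> mF; apply: (measurableT_comp (measurable_consv_pair mF)).
exact: measurable_pair1.
Qed.

Lemma measurable_consvl n (F : Rvec R n.+1 -> \bar R) v :
  measurable_fun setT F ->
  measurable_fun setT (fun x : measurableTypeR R => F (consv (x, v))).
Proof.
move=> mF; apply: (measurableT_comp (measurable_consv_pair mF)).
exact: measurable_pair2.
Qed.

Lemma integral_lebnS n (F : Rvec R n.+1 -> \bar R) :
  measurable_fun setT F -> (forall v, 0 <= F v) ->
  \int[lebn n.+1]_v F v = \int[leb]_x \int[lebn n]_v F (consv (x, v)).
Proof.
move=> mF F0; rewrite -vintE// vintS.
by apply: eq_integral => x _; rewrite vintE//; exact: measurable_consvr.
Qed.

Lemma integral_lebnS_swap n (F : Rvec R n.+1 -> \bar R) :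
  measurable_fun setT F -> (forall v, 0 <= F v) ->
  \int[lebn n.+1]_v F v = \int[lebn n]_v \int[leb]_x F (consv (x, v)).
Proof.
move=> mF F0; rewrite integral_lebnS//.
apply: (fubini_tonelli (F \o @consv R n)); first exact: measurable_consv_pair.
by move=> ?; exact: F0.
Qed.

Lemma integral_lebn_translate n (w : 'cV[R]_n) (F : Rvec R n -> \bar R) :
  measurable_fun setT F -> (forall v, 0 <= F v) ->
  \int[lebn n]_v F (v + w)%R = \int[lebn n]_v F v.
Proof.
elim: n w F => [|n IH] w F mF F0.
  by apply: eq_integral => v _; congr F; apply/colP => -[].
rewrite integral_lebnS//; last first.
  exact: (measurableT_comp mF (measurable_addmx w)).
rewrite [RHS]integral_lebnS//.
pose G x := \int[lebn n]_v F (consv (x, v)).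
transitivity (\int[leb]_x G (1 * x + w 0 0)%R).
  apply: eq_integral => x _; rewrite mul1r.
  rewrite -[RHS](IH (@dsubmx R 1 n 1 w))//; last exact: measurable_consvr.
  apply: eq_integral => v _; congr F.
  rewrite -[in LHS](unconsvK w) /consv (@add_col_mx _ 1 n)/=.
  by rewrite -raddfD.
rewrite -[RHS](@ge0_integral_affine _ 1 (w 0 0)%R)// ?normr1 ?mul1e ?oner_neq0//.
  apply: (@measurable_fun_fubini_tonelli_F _ _ _ _ _ (lebn n) (F \o @consv R n)).
    exact: measurable_consv_pair.
  by move=> ?; exact: F0.
by move=> x; apply: integral_ge0.
Qed.

(** The change of variables formula as a property of [M]: it passes to products, so factors of
    simple shape suffice. *)
Definition scales_lebn n (M : 'M[R]_n) := forall F : Rvec R n -> \bar R,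
  measurable_fun setT F -> (forall v, 0 <= F v) ->
  `|\det M|%:E * \int[lebn n]_v F (M *m v)%R = \int[lebn n]_v F v.

Lemma scales_lebnM n (M N : 'M[R]_n) :
  scales_lebn M -> scales_lebn N -> scales_lebn (M *m N).
Proof.
move=> sM sN F mF F0; rewrite -[RHS]sM// -[in RHS]sN//; last first.
  exact: (measurableT_comp mF (measurable_mulmx _)).
rewrite det_mulmx normrM EFinM muleA; congr (_ * _).
by apply: eq_integral => v _; rewrite mulmxA.
Qed.

(** With the tail v fixed, the head undergoes the affine map x -> a x + r v, which is why the head
    is integrated innermost here. What remains is the action of [D] on the tail. *)
Lemma scales_lebn_ublock n (a : R) (r : 'rV[R]_n) (D : 'M[R]_n) : a != 0%R ->
  scales_lebn D -> @scales_lebn n.+1 (block_mx a%:M r 0 D : 'M[R]_(1 + n)).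
Proof.
move=> a0 sD F mF F0.
rewrite (@det_ublock _ 1 n) det_scalar1 normrM mulrC EFinM.
rewrite integral_lebnS_swap//; last first.
  exact: (measurableT_comp mF (measurable_mulmx _)).
rewrite [RHS]integral_lebnS_swap//.
pose G v := \int[leb]_x F (consv (x, v)).
have mG : measurable_fun setT G.
  apply: (@measurable_fun_fubini_tonelli_G _ _ _ _ _ leb (F \o @consv R n)).
    exact: measurable_consv_pair.
  by move=> ?; exact: F0.
have G0 v : 0 <= G v by exact: integral_ge0.
rewrite -[RHS]sD// -muleA; congr (_ * _).
rewrite -ge0_integralZl//; last 2 first.
- apply: (@measurable_fun_fubini_tonelli_G _ _ _ _ _ leb
    (fun z => F (block_mx a%:M r 0 D *m consv z)%R)) => //.
  apply: (measurableT_comp mF); apply: (measurableT_comp (measurable_mulmx _)).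
  exact: measurable_consv.
- by move=> v _; exact: integral_ge0.
apply: eq_integral => v _.
rewrite -[RHS](@ge0_integral_affine _ a ((r *m v) 0 0)%R)//; last exact: measurable_consvl.
congr (_ * _); apply: eq_integral => x _; congr F.
rewrite /consv (@mul_block_col _ 1 n 1 n 1)/= mul0mx add0r; congr (@col_mx _ 1 n 1 _ _).
by apply/matrixP => i j; rewrite !ord1 !mxE big_ord1 !mxE eqxx !mulr1n.
Qed.

(** A shear: with the head x fixed, the tail is merely translated by c x. *)
Lemma scales_lebn_lblock n (c : 'cV[R]_n) :
  @scales_lebn n.+1 (block_mx 1%:M 0 c 1%:M : 'M[R]_(1 + n)).
Proof.
move=> F mF F0; rewrite (@det_lblock _ 1 n) !det1 mulr1 normr1 mul1e.
rewrite integral_lebnS//; last first.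
  exact: (measurableT_comp mF (measurable_mulmx _)).
rewrite [RHS]integral_lebnS//.
apply: eq_integral => x _.
rewrite -[RHS](integral_lebn_translate (c *m x%:M))//; last exact: measurable_consvr.
apply: eq_integral => v _; congr F.
by rewrite /consv (@mul_block_col _ 1 n 1 n 1)/= mul0mx addr0 !mul1mx addrC.
Qed.

Lemma scales_lebn1 n : scales_lebn (1%:M : 'M[R]_n).
Proof.
move=> F mF F0; rewrite det1 normr1 mul1e.
by apply: eq_integral => v _; rewrite mul1mx.
Qed.

(* Induction on the size by Schur complements; a vanishing pivot is repaired by
   adding another row to the first one. *)
Lemma scales_lebn_unitmx n (M : 'M[R]_n) : M \in unitmx -> scales_lebn M.
Proof.
elim: n M => [M _|n IH M].
  suff -> : M = 1%:M by exact: scales_lebn1.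
  by apply/matrixP => -[].
have pivot (N : 'M[R]_(1 + n)) : N \in unitmx -> N 0%R 0%R != 0%R ->
    @scales_lebn n.+1 N.
  move=> uN a0; set a := N _ _ in a0.
  have NE : N = block_mx 1%:M 0 (a^-1 *: dlsubmx N) 1%:M *m
      block_mx a%:M (ursubmx N) 0 (drsubmx N - a^-1 *: (dlsubmx N *m ursubmx N)).
    rewrite mulmx_block !mul1mx !mul0mx !addr0 -[LHS]submxK.
    congr block_mx.
    - by rewrite [LHS]mx11_scalar !mxE; congr (N _ _)%:M; apply/val_inj.
    - by rewrite mul_mx_scalar scalerA mulfV// scale1r.
    - by rewrite -scalemxAl addrC subrK.
  move: uN; rewrite {1}NE unitmx_mul => /andP[_]; rewrite unitmxE det_ublock.
  rewrite det_scalar1 unitfE mulf_eq0 negb_or => /andP[_ uD].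
  rewrite NE; apply: (@scales_lebnM n.+1); first exact: scales_lebn_lblock.
  by apply: scales_lebn_ublock => //; apply: IH; rewrite unitmxE unitfE.
move=> uM; have [M00|] := eqVneq (M 0%R 0%R) 0%R; last exact: pivot.
have [i Mi] : exists i : 'I_n, M (lift ord0 i) 0%R != 0%R.
  apply: contrapT => /forallNP Mi; move: uM; rewrite unitmxE unitfE => /eqP; apply.
  rewrite (expand_det_col _ 0%R) big1// => j _.
  suff -> : M j 0%R = 0%R by rewrite mul0r.
  have [k ->|->//] := unliftP ord0 j.
  by apply/eqP; apply/negPn/negP; exact: Mi.
pose E (c : R) : 'M[R]_(1 + n) := (block_mx 1%:M (c *: delta_mx 0 i) 0 1%:M)%R.
have uE c : E c \in unitmx by rewrite unitmxE det_ublock !det1 mulr1 unitr1.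
have EE : E (-1)%R *m E 1%R = 1%:M.
  rewrite mulmx_block !mul1mx !mulmx1 !mul0mx !mulmx0 !addr0 add0r.
  by rewrite scale1r scaleN1r subrr -scalar_mx_block.
rewrite -[M]mul1mx -EE -mulmxA; apply: (@scales_lebnM n.+1).
  by apply: scales_lebn_ublock; [exact: oner_neq0|exact: scales_lebn1].
apply: pivot; first by rewrite unitmx_mul uE.
have -> : (E 1%R *m M) 0%R 0%R = (M 0%R 0%R + M (lift ord0 i) 0%R)%R.
  have e0 : (0 : 'I_(1 + n))%R = lshift n 0%R by exact/val_inj.
  rewrite mxE (@big_split_ord _ _ _ 1 n) big_ord1 /= (bigD1 i)//= big1 => [|j ji].
    rewrite addr0 /E [in X in E _ X]e0 block_mxEul block_mxEur !mxE !eqxx mulr1n !mul1r.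
    by congr (M _ _ + M _ _)%R; exact/val_inj.
  by rewrite /E [X in fun_of_matrix _ X]e0 block_mxEur !mxE (negbTE ji) andbF mulr0 mul0r.
by rewrite M00 add0r.
Qed.

End linear_change.

(** * Differential entropy of linear images *)

Section entropy.
Context {R : realType}.
Implicit Types n : nat.
Local Open Scope ereal_scope.

Lemma measurable_xlnx n (f : Rvec R n -> R) : measurable_fun setT f ->
  measurable_fun setT (fun v => - (f v * ln (f v)))%R.
Proof.
move=> mf; apply: measurableT_comp => //.
by apply: measurable_funM => //; exact: (measurableT_comp (@measurable_ln R)).
Qed.

Lemma entropy_of_densityE n (f : Rvec R n -> R) : measurable_fun setT f ->
  entropy_of_density f = \int[lebn n]_v (- (f v * ln (f v)))%:E.
Proof.
move=> mf; rewrite integralE /entropy_of_density.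
have mx := measurable_xlnx mf.
have mN : measurable_fun setT (fun v => f v * ln (f v))%R.
  rewrite (_ : (fun _ => _) = fun v => - - (f v * ln (f v)))%R.
    exact: (measurableT_comp (@oppr_measurable R setT) mx).
  by apply/funext => v; rewrite opprK.
congr (_ - _); rewrite vintE.
- by apply: eq_integral => v _; rewrite funeposE EFin_max.
- exact/measurable_EFinP/measurable_maxr.
- by move=> v; rewrite lee_fin le_max lexx orbT.
- by apply: eq_integral => v _; rewrite funenegE EFin_max -EFinN opprK.
- exact/measurable_EFinP/measurable_maxr.
- by move=> v; rewrite lee_fin le_max lexx orbT.
Qed.

Section law.
Context {d : measure_display} {T : measurableType d} {P : probability T R}.

Lemma is_density_integral n (X : T -> 'cV[R]_n) f : is_density P X f ->
  forall A : set (Rvec R n), measurable A ->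
  P (X @^-1` A) = \int[lebn n]_(v in A) (f v)%:E.
Proof.
move=> [mf f0 fP] A mA; rewrite fP// vintE.
- rewrite [RHS]integral_mkcond; apply: eq_integral => v _.
  by rewrite patchE indicE; case: ifPn; rewrite ?mul1r ?mul0r.
- apply/measurable_EFinP; apply: measurable_funM => //.
- by move=> v; rewrite lee_fin mulr_ge0.
Qed.

Lemma integrable_density n (X : T -> 'cV[R]_n) f : is_density P X f ->
  (lebn n).-integrable setT (EFin \o f).
Proof.
move=> fX; have [mf f0 _] := fX.
apply/integrableP; split; first exact/measurable_EFinP.
under eq_integral do rewrite /= ger0_norm//.
by rewrite -(is_density_integral fX)// preimage_setT probability_setT ltry.
Qed.

Lemma integral_density n (X : T -> 'cV[R]_n) f : is_density P X f ->
  \int[lebn n]_v (f v)%:E = 1.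
Proof.
by move=> fX; rewrite -(is_density_integral fX)// preimage_setT probability_setT.
Qed.

(** Two densities of one law agree almost everywhere, so the density chosen inside [diff_entropy]
    does not matter. *)
Lemma entropy_of_density_unique n (X : T -> 'cV[R]_n) f g :
  is_density P X f -> is_density P X g ->
  entropy_of_density f = entropy_of_density g.
Proof.
move=> fX gX; have [mf _ _] := fX; have [mg _ _] := gX.
rewrite !entropy_of_densityE//.
apply: ae_eq_integral => //.
- by apply/measurable_EFinP; exact: measurable_xlnx.
- by apply/measurable_EFinP; exact: measurable_xlnx.
have : ae_eq (lebn n) setT (EFin \o f) (EFin \o g).
  apply: integral_ae_eq => //.
  - exact: integrable_density fX.
  - exact/measurable_EFinP.
  by move=> E _ mE; rewrite /= -(is_density_integral fX)// -(is_density_integral gX).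
by apply: filterS => v /= fg vT; have [->] := fg vT.
Qed.

Lemma diff_entropyE n (X : T -> 'cV[R]_n) f : is_density P X f ->
  diff_entropy P X = entropy_of_density f.
Proof.
move=> fX; rewrite /diff_entropy; case: pselect => [H|]; last by case; exists f.
exact: entropy_of_density_unique (proj2_sig (cid H)) fX.
Qed.

Lemma integral_lebn_linear n (M : 'M[R]_n) (H : Rvec R n -> \bar R) :
  M \in unitmx -> (lebn n).-integrable setT H ->
  `|\det M|%:E * \int[lebn n]_v H (M *m v)%R = \int[lebn n]_v H v.
Proof.
move=> uM iH; have mH : measurable_fun setT H by exact: measurable_int iH.
have mHp := measurable_funepos mH; have mHn := measurable_funeneg mH.
have dM : (0 < `|\det M|)%R by rewrite normr_gt0 -unitfE -unitmxE.
rewrite [RHS]integralE -(scales_lebn_unitmx uM mHp)// -(scales_lebn_unitmx uM mHn)//.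
rewrite -muleBr//; last first.
  apply: fin_num_adde_defr.
  have := integrable_pos_fin_num measurableT iH.
  rewrite -(scales_lebn_unitmx uM mHp)//.
  case: (\int[_]_v _) => //=; first by rewrite gt0_muley ?lte_fin.
  by rewrite gt0_muleNy ?lte_fin.
congr (_ * _); rewrite [LHS]integralE; congr (_ - _); apply: eq_integral => v _.
- by rewrite !funeposE.
- by rewrite !funenegE.
Qed.

(** A difference of extended reals is finite only if both terms are, here the integrals of the
    positive and negative parts. *)
Lemma integrable_entropy n (f : Rvec R n -> R) : measurable_fun setT f ->
  entropy_of_density f \is a fin_num ->
  (lebn n).-integrable setT (fun v => (- (f v * ln (f v)))%:E).
Proof.
move=> mf; rewrite entropy_of_densityE// integralE fin_numB => /andP[hp hn].
have mx := measurable_xlnx mf.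
have mE : measurable_fun setT (fun v => (- (f v * ln (f v)))%:E).
  exact/measurable_EFinP.
apply/integrableP; split => //.
under eq_integral do rewrite -/((abse \o (fun v => (- (f v * ln (f v)))%:E)) _) fune_abse.
rewrite ge0_integralD//.
- by rewrite lte_add_pinfty// ltey_eq ?hp ?hn.
- exact: measurable_funepos.
- exact: measurable_funeneg.
Qed.

Lemma is_density_linear n (M : 'M[R]_n) (X : T -> 'cV[R]_n) f :
  M \in unitmx -> is_density P X f ->
  is_density P (fun w => M *m X w)
    (fun v => `|\det (invmx M)| * f (invmx M *m v))%R.
Proof.
move=> uM [mf f0 fX].
have mfM : measurable_fun setT (fun v : Rvec R n => f (invmx M *m v)%R).
  exact: (measurableT_comp mf (measurable_mulmx (invmx M))).
have mA1 A : measurable A -> measurable_fun setT (fun v : Rvec R n => (\1_A v : R)).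
  by move=> mA; exact: measurable_indic.
split.
- exact: measurable_funM.
- by move=> v; rewrite mulr_ge0.
- move=> A mA.
  have mMA : measurable ((fun v : Rvec R n => M *m v : Rvec R n) @^-1` A).
    by rewrite -[_ @^-1` _]setTI; exact: measurable_mulmx.
  set B := _ @^-1` A in mMA.
  have mg : measurable_fun setT (fun v : Rvec R n => \1_B v * f v)%R.
    by apply: measurable_funM => //; exact: mA1.
  have g0 (v : Rvec R n) : 0 <= (\1_B v * f v)%:E by rewrite lee_fin mulr_ge0.
  rewrite (fX B mMA) !vintE.
  + rewrite -[LHS](scales_lebn_unitmx (M := invmx M)) ?unitmx_inv//.
    * rewrite -ge0_integralZl//.
      - apply: eq_integral => v _; rewrite -EFinM; congr EFin.
        rewrite mulrCA; congr (_ * _)%R.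
        rewrite !indicE; congr (nat_of_bool _)%:R.
        by apply/idP/idP; rewrite !inE /B/= mulKVmx.
      - apply/measurable_EFinP.
        exact: (measurableT_comp mg (measurable_mulmx (invmx M))).
    * exact/measurable_EFinP.
  + apply/measurable_EFinP; apply: measurable_funM; first exact: mA1.
    exact: measurable_funM.
  + by move=> v; rewrite lee_fin !mulr_ge0.
  + exact/measurable_EFinP.
  + exact: g0.
Qed.

Lemma diff_entropy_linear n (M : 'M[R]_n) (X : T -> 'cV[R]_n) :
  M \in unitmx -> diff_entropy P X \is a fin_num ->
  diff_entropy P (fun w => M *m X w) = diff_entropy P X + (ln `|\det M|)%:E.
Proof.
move=> uM; case: (pselect (exists f, is_density P X f)) => [[f fX]|nX]; last first.
  (* Without a density the entropy is -oo, against finiteness. *)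
  by rewrite {1}/diff_entropy; case: pselect.
have fMX := is_density_linear uM fX.
rewrite (diff_entropyE fX) (diff_entropyE fMX) => hfin.
have [mf f0 _] := fX; have [mfM _ _] := fMX.
rewrite entropy_of_densityE//.
set c := `|\det (invmx M)|%R.
have c0 : (0 < c)%R by rewrite normr_gt0 det_inv invr_eq0 -unitfE -unitmxE.
have iE := integrable_entropy mf hfin.
have iF := integrable_density fX.
(* The density of M X at v is c f(M^-1 v), and - c f ln (c f) = c (- f ln f - (ln c) f); [H] is the
   bracket. *)
pose H v := (- (f v * ln (f v)))%:E - (ln c)%:E * (f v)%:E.
have iH : (lebn n).-integrable setT H.
  by apply: integrableB => //; exact: integrableZl.
pose H' v := c%:E * H v.
have iH' : (lebn n).-integrable setT H' by exact: integrableZl.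
transitivity (\int[lebn n]_v H' (invmx M *m v)%R).
  apply: eq_integral => v _; rewrite /H' /H; set w := f _.
  rewrite -!EFinM; congr EFin.
  have : (0 <= w)%R by exact: f0.
  (* Where the density vanishes [lnM] does not apply, but both sides are 0. *)
  rewrite le_eqVlt => /predU1P[<-|w0]; first by rewrite !(mulr0, mul0r, oppr0, subr0).
  by rewrite lnM ?posrE//; ring.
(* The factor c in [H'] cancels the Jacobian of M^-1. *)
have -> : \int[lebn n]_v H' (invmx M *m v)%R = \int[lebn n]_v H v.
  have := integral_lebn_linear (M := invmx M) _ iH'.
  rewrite unitmx_inv => /(_ uM); rewrite -/c.
  rewrite [in X in _ = X -> _]integralZl// => /(congr1 (mule (c^-1)%:E)).
  by rewrite !muleA -!EFinM mulVf ?gt_eqF// !mul1e.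
rewrite integralB//; last exact: integrableZl.
rewrite integralZl// (integral_density fX) mule1 -entropy_of_densityE//.
by rewrite /c det_inv normfV lnV ?posrE ?normr_gt0 -?unitfE -?unitmxE// EFinN oppeK.
Qed.

End law.
End entropy.

(** * Real symmetric matrices and the thin singular value decomposition *)

Section real_spectral.
Context {R : rcfType}.

(** An eigenvector w exists over the complex extension, and the scalar w B w^H equals its own
    conjugate, so the eigenvalue is real. It is then a root of the real characteristic polynomial,
    which provides a real eigenvector to normalise. *)
Lemma symmetric_eigenvalue n (A : 'M[R]_n.+1) : A^T = A ->
  exists a (v : 'rV[R]_n.+1), v *m v^T = 1%:M /\ v *m A = a *: v.
Proof.
move=> symA; pose toC := @real_complex R.
pose B := map_mx toC A.
have [z /eigenvalueP[w wB w0]] := eigenvalue_closed B (ltn0Sn n).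
have symB : map_mx Num.conj B^T = B.
  apply/matrixP => i j; rewrite !mxE -[in RHS]symA mxE.
  by apply: conj_Creal; rewrite complex_real.
pose ws := map_mx Num.conj w^T.
have nw : (w *m ws) 0 0 != 0.
  rewrite mxE; under eq_bigr do rewrite !mxE -normCK.
  apply: contra w0; rewrite psumr_eq0 => [|i _]; last exact: exprn_ge0.
  move=> /allP h; apply/eqP/rowP => i; rewrite mxE.
  have /implyP/(_ isT) := h i (mem_index_enum _).
  by rewrite expf_eq0/= normr_eq0 => /eqP.
have wsT : map_mx Num.conj ws^T = w.
  by apply/matrixP => i j; rewrite !mxE conjCK.
pose N := (w *m ws) 0 0.
have NE : w *m ws = N%:M by rewrite [LHS]mx11_scalar.
have Nr : N^* = N.
  apply: conj_Creal; rewrite /N mxE; apply: rpred_sum => i _.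
  by rewrite !mxE -normCK realX// normr_real.
have zr : z^* = z.
  have e1 : w *m B *m ws = (z * N)%:M by rewrite wB -scalemxAl NE scale_scalar_mx.
  have e2 : map_mx Num.conj (w *m B *m ws)^T = w *m B *m ws.
    by rewrite !trmx_mul !map_mxM symB wsT mulmxA.
  have := congr1 (fun M : 'M[R[i]]_1 => M 0 0) e2; rewrite e1 !mxE eqxx !mulr1n => h.
  by apply: (mulIf nw); rewrite -/N -{1}Nr -rmorphM.
have zE : z = toC (complex.Re z).
  by rewrite /toC RRe_real//; apply/CrealP.
have rz : root (char_poly A) (complex.Re z).
  have : root (char_poly B) (toC (complex.Re z)).
    by rewrite -zE -eigenvalue_root_char; apply/eigenvalueP; exists w.
  by rewrite -map_char_poly fmorph_root.
have /eigenvalueP[v vA v0] : eigenvalue A (complex.Re z) by rewrite eigenvalue_root_char.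
pose K := (v *m v^T) 0 0.
have K0 : 0 < K.
  rewrite /K mxE; under eq_bigr do rewrite mxE -expr2.
  rewrite lt_def sumr_ge0 ?andbT => [|i _]; last exact: sqr_ge0.
  apply: contra v0; rewrite psumr_eq0 => [|i _]; last exact: sqr_ge0.
  move=> /allP h; apply/eqP/rowP => i; rewrite mxE.
  have /implyP/(_ isT) := h i (mem_index_enum _).
  by rewrite expf_eq0/= => /eqP.
exists (complex.Re z), ((Num.sqrt K)^-1 *: v); split; last first.
  by rewrite -scalemxAl vA !scalerA mulrC.
rewrite linearZ/= -scalemxAl -scalemxAr scalerA [v *m _]mx11_scalar -/K.
rewrite scale_scalar_mx -invfM -expr2 sqr_sqrtr ?ltW// mulVf ?gt_eqF//.
Qed.

(** The Householder reflection along w = v - e exchanges the unit vectors e and v; [N] is |w|^2 and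
    b the inner product of v and e. It degenerates when v = e, where the identity serves. *)
Lemma orthogonal_completion n (v : 'rV[R]_n.+1) : v *m v^T = 1%:M ->
  exists Q : 'M[R]_n.+1, Q *m Q^T = 1%:M /\ row 0 Q = v.
Proof.
move=> vv; pose e : 'rV[R]_n.+1 := delta_mx 0 0; pose w := v - e.
have ee : e *m e^T = 1%:M.
  by rewrite trmx_delta mul_delta_mx; apply/matrixP=> i j; rewrite !mxE !ord1.
have [w0|w0] := eqVneq w 0.
  exists 1%:M; rewrite trmx1 mulmx1; split => //.
  by rewrite row1; apply/esym/eqP; rewrite -subr_eq0; apply/eqP.
pose b := (v *m e^T) 0 0.
have veb : v *m e^T = b%:M by rewrite [LHS]mx11_scalar.
have evb : e *m v^T = b%:M by rewrite -[LHS]trmxK trmx_mul trmxK veb tr_scalar_mx.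
pose N := 2 - 2 * b.
have ww : w *m w^T = N%:M.
  rewrite /w linearB/= mulmxBl !mulmxBr vv ee veb evb -!raddfB/=.
  by congr (_%:M); rewrite /N; ring.
have N0 : N != 0.
  apply: contra w0 => /eqP N0; apply/eqP/rowP => i; rewrite [RHS]mxE.
  have := congr1 (fun M : 'M[R]_1 => M 0 0) ww; rewrite N0 mxE [RHS]mxE mul0rn.
  under eq_bigr do rewrite [w^T _ _]mxE -expr2.
  move=> /eqP; rewrite psumr_eq0 => [|j _]; last exact: sqr_ge0.
  move=> /allP h; have /implyP/(_ isT) := h i (mem_index_enum _).
  by rewrite expf_eq0/= => /eqP.
pose K := 2 / N; pose W := w^T *m w.
have WW : W *m W = N *: W.
  by rewrite /W mulmxA -(mulmxA w^T) ww mul_mx_scalar scalemxAl.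
have KN : K * (K * N) = K + K by rewrite /K; field.
pose Q := 1%:M - K *: W.
have QT : Q^T = Q by rewrite /Q linearB/= trmx1 linearZ/= /W trmx_mul trmxK.
exists Q; split.
  rewrite QT /Q mulmxBl mul1mx mulmxBr mulmx1 -scalemxAl -scalemxAr WW !scalerA -mulrA KN.
  by rewrite scalerDl opprB [in X in _ + X]addrK subrK.
rewrite rowE -/e /Q mulmxBr mulmx1 -scalemxAr /W mulmxA.
have -> : e *m w^T = (b - 1)%:M by rewrite /w linearB/= mulmxBr evb ee -raddfB.
rewrite mul_scalar_mx scalerA (_ : K * (b - 1) = -1); last first.
  by rewrite /K /N; field; rewrite -/N.
by rewrite scaleN1r opprK /w addrC subrK.
Qed.

(** Deflation: in an orthonormal basis starting with a unit eigenvector the first row, hence by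
    symmetry the first column, vanishes off the diagonal, and the induction handles the remaining
    block. *)
Lemma real_symmetric_spectral n (A : 'M[R]_n) : A^T = A ->
  exists (C : 'M[R]_n) (D : 'rV[R]_n), C *m C^T = 1%:M /\ A = C^T *m diag_mx D *m C.
Proof.
elim: n A => [|n IH] A symA.
  by exists 1%:M, 0; split; apply/matrixP => -[].
have [a [v [vv vA]]] := symmetric_eigenvalue symA.
have [Q [QQ rQ]] := orthogonal_completion vv.
have QQ' : Q^T *m Q = 1%:M by exact: mulmx1C.
have [B Bdef] : exists B : 'M[R]_(1 + n), B = Q *m A *m Q^T by eexists.
have symB : B^T = B by rewrite Bdef !trmx_mul trmxK symA mulmxA.
have rB : row 0 B = a *: delta_mx 0 0.
  rewrite Bdef rowE !mulmxA -rowE rQ vA -scalemxAl -rQ rowE -!mulmxA QQ mulmx1.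
  by [].
have B0 j : B 0 j = a * (j == 0)%:R.
  by have /rowP/(_ j) := rB; rewrite !mxE eqxx.
have e0 : @lshift 1 n 0 = 0 by exact/val_inj.
have BE : B = block_mx a%:M 0 0 (drsubmx B).
  rewrite -[LHS]submxK; congr block_mx; apply/matrixP => i j.
  - by rewrite !ord1 !mxE e0 B0 eqxx mulr1.
  - by rewrite ord1 !mxE e0 B0 mulr0.
  - by rewrite ord1 !mxE e0 -symB mxE B0 mulr0.
have symB' : (drsubmx B)^T = drsubmx B by rewrite trmx_drsub symB.
have [C [D [CC BD]]] := IH _ symB'.
pose C1 : 'M[R]_(1 + n) := block_mx 1%:M 0 0 C.
have C1C1 : C1 *m C1^T = 1%:M.
  rewrite /C1 tr_block_mx !trmx0 trmx1 mulmx_block !mulmx0 !mul0mx !mulmx1 CC.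
  by rewrite !addr0 add0r -scalar_mx_block.
exists (C1 *m Q), (row_mx a%:M D); split.
  by rewrite trmx_mul mulmxA -(mulmxA C1) QQ mulmx1.
have -> : A = Q^T *m B *m Q.
  by rewrite Bdef !mulmxA QQ' mul1mx -mulmxA QQ' mulmx1.
rewrite trmx_mul mulmxA; congr (_ *m _); rewrite -!mulmxA; congr (_ *m _).
rewrite BE BD (@diag_mx_row _ n 1) /C1 (@tr_block_mx _ 1 n 1 n) !trmx0 trmx1.
rewrite !(@mulmx_block _ 1 n 1 n 1 n).
rewrite !(mulmx0, mul0mx, mulmx1, mul1mx, addr0, add0r) mulmxA.
congr (@block_mx _ 1 n 1 n _ _ _ _).
by apply/matrixP => i j; rewrite !ord1 !mxE eqxx.
Qed.

(** From S^T S = C^T D C take T = D^(1/2) and A = T^-1 C S^T. The entries of D are nonnegative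
    because diag D is the Gram matrix of the rows of C S^T, and nonzero because the determinant
    is. *)
Lemma thin_svd_exists m n (S : 'M[R]_(m, n)) : \det (S^T *m S) != 0 ->
  exists (A : 'M[R]_(n, m)) (T C : 'M[R]_n),
  [/\ S = A^T *m T *m C, A *m A^T = 1%:M, is_diag_mx T, (forall i, 0 < T i i) &
    C *m C^T = 1%:M /\ C^T *m C = 1%:M].
Proof.
move=> dS; have symS : (S^T *m S)^T = S^T *m S by rewrite trmx_mul trmxK.
have [C [D [CC SD]]] := real_symmetric_spectral symS.
have CC' : C^T *m C = 1%:M by exact: mulmx1C.
have DE : diag_mx D = C *m S^T *m (C *m S^T)^T.
  rewrite trmx_mul trmxK mulmxA -(mulmxA C) SD.
  by rewrite !mulmxA CC mul1mx -mulmxA CC mulmx1.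
have D0 i : 0 < D 0 i.
  rewrite lt_def; apply/andP; split.
    apply: contra dS => /eqP Di; rewrite SD !det_mulmx det_diag (bigD1 i)//= Di.
    by rewrite mul0r mulr0 mul0r.
  have /matrixP/(_ i i) := DE; rewrite !mxE eqxx mulr1n => ->.
  by apply: sumr_ge0 => k _; rewrite [_^T _ _]mxE -expr2 sqr_ge0.
pose t := \row_i Num.sqrt (D 0 i); pose ti := \row_i (Num.sqrt (D 0 i))^-1.
have st i : Num.sqrt (D 0 i) != 0 by rewrite gt_eqF// sqrtr_gt0.
have tti : diag_mx ti *m diag_mx t = 1%:M.
  rewrite mulmx_diag -diag_const_mx; congr diag_mx.
  by apply/rowP => i; rewrite !mxE mulVf.
have tDt : diag_mx ti *m diag_mx D *m diag_mx ti = 1%:M.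
  rewrite !mulmx_diag -diag_const_mx; congr diag_mx.
  apply/rowP => i; rewrite !mxE -[X in _ * X * _]sqr_sqrtr ?ltW//.
  by rewrite expr2 mulrA mulVf// mul1r mulfV.
exists (diag_mx ti *m C *m S^T), (diag_mx t), C; split => //.
- rewrite !trmx_mul trmxK tr_diag_mx -!mulmxA (mulmxA (diag_mx ti)) tti mul1mx.
  by rewrite CC' mulmx1.
- rewrite -[diag_mx ti *m C *m _]mulmxA; set Z := C *m S^T in DE *.
  by rewrite trmx_mul tr_diag_mx mulmxA -(mulmxA (diag_mx ti)) -DE.
- by move=> i; rewrite !mxE eqxx mulr1n sqrtr_gt0.
Qed.

(** The orthonormal rows of [A] drop out of S^T S. The right-hand side depends on S alone, so the
    choice of decomposition does not affect the effective entropy. *)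
Lemma det_thin_svd m n (S : 'M[R]_(m, n)) (A : 'M[R]_(n, m)) (T C : 'M[R]_n) :
  S = A^T *m T *m C -> A *m A^T = 1%:M ->
  \det (T *m C) ^+ 2 = \det (S^T *m S).
Proof.
move=> -> AA.
rewrite !trmx_mul trmxK -!mulmxA (mulmxA A) AA mul1mx mulmxA.
by rewrite !det_mulmx !det_tr; ring.
Qed.
End real_spectral.

(** * Growth of Gram determinants of convolution matrices *)

Section toeplitz.
Local Open Scope sesquilinear_scope.
Context {C : numClosedFieldType}.
Implicit Types (p q H : {poly C}) (s : seq C).

(** Column j lists the coefficients of X^j p, cut after l rows: multiplication by p on polynomials
    of degree below n. *)
Definition convmx (l n : nat) p : 'M[C]_(l, n) :=
  \matrix_(i < l, j < n) if (j <= i)%N then p`_(i - j) else 0.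

Lemma convmxB l n p q : convmx l n (p - q) = convmx l n p - convmx l n q.
Proof. by apply/matrixP => i j; rewrite !mxE; case: ifP; rewrite ?coefB ?subr0. Qed.

Lemma convmxZ l n a p : convmx l n (a *: p) = a *: convmx l n p.
Proof. by apply/matrixP => i j; rewrite !mxE; case: ifP; rewrite ?coefZ ?mulr0. Qed.

(** Multiplication by X moves every column down by one row. The size condition leaves the last row
    of the unshifted matrix empty, so nothing is lost and inner products of columns are
    unchanged. *)
Lemma gram_convmx_mulX l n H : (n + size H <= l)%N ->
  (convmx l n ('X * H))^t* *m convmx l n ('X * H) =
  (convmx l n H)^t* *m convmx l n H.
Proof.
case: l => [|l] nHl; apply/matrixP => i j; rewrite !mxE; first by rewrite !big_ord0.
rewrite big_ord_recl big_ord_recr/= !mxE/=.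
have -> : (if (j <= 0)%N then ('X * H)`_(0 - j) else 0) = 0.
  by case: ifP => // j0; rewrite sub0n coefXM.
have -> : (if (j <= l)%N then H`_(l - j) else 0) = 0.
  case: ifP => // jl; apply: nth_default.
  have szH : (size H <= l.+1 - n)%N by move: nHl; lia.
  by apply: leq_trans szH _; have := ltn_ord j; lia.
rewrite !mulr0 add0r addr0; apply: eq_bigr => k _; rewrite !mxE/=.
have E (c : 'I_n) : (if (c <= bump 0 k)%N then ('X * H)`_(bump 0 k - c) else 0) =
    (if (c <= k)%N then H`_(k - c) else 0).
  rewrite /bump/= add1n; case: ltngtP => ck.
  - by rewrite coefXM -ltnS ck subn_eq0 leqNgt ck/= subSn.
  - by case: leqP => // ck'; move: (leq_ltn_trans ck' (ltnW ck)); rewrite ltnn.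
  - by rewrite ck ltnn subnn coefXM.
by rewrite !E.
Qed.

(* On the unit circle |z - a| = |1 - conj a z|, so the Gram matrix does not see
   the reflection of a root across the circle. *)
Lemma gram_convmx_reflect l n a H : (n + size H <= l)%N ->
  (convmx l n (('X - a%:P) * H))^t* *m convmx l n (('X - a%:P) * H) =
  (convmx l n ((1 - a^* *: 'X) * H))^t* *m convmx l n ((1 - a^* *: 'X) * H).
Proof.
move=> /gram_convmx_mulX; rewrite !mulrBl mul1r -scalerAl mul_polyC !convmxB !convmxZ.
set Z := convmx _ _ ('X * H); set K := convmx _ _ H => ZK.
have E (X Y : 'M[C]_(l, n)) c : (X - c *: Y)^t* = X^t* - c^* *: Y^t*.
  by apply/matrixP => i j; rewrite !mxE rmorphB rmorphM.
rewrite !E conjCK !mulmxBl !mulmxBr.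
rewrite -!scalemxAl -!scalemxAr ZK.
set A := K^t* *m K; set B := Z^t* *m K; set B' := K^t* *m Z.
(* Since Z and K have the same Gram matrix, both sides are (1 + |a|^2) A - a B - conj(a) B'. *)
by apply/matrixP => i j; rewrite !mxE /=; ring.
Qed.

Definition reflect_root a : {poly C} :=
  if 1 <= `|a| then 'X - a%:P else 1 - a^* *: 'X.

Lemma size_reflect_root a : (size (reflect_root a) <= 2)%N.
Proof.
rewrite /reflect_root; case: ifP => _; first by rewrite size_XsubC.
apply: leq_trans (size_polyD _ _) _; rewrite size_polyN geq_max size_poly1/=.
by apply: leq_trans (size_scale_leq _ _) _; rewrite size_polyX.
Qed.

(** Roots are reflected one at a time and the treated factors move into [H], over which the
    induction generalises. The size condition keeps the full columns within the l rows. *)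
Lemma gram_convmx_reflect_prod l n H s : (n + size H + size s <= l.+1)%N ->
  let P := H * \prod_(a <- s) ('X - a%:P) in
  let Q := H * \prod_(a <- s) reflect_root a in
  (convmx l n P)^t* *m convmx l n P = (convmx l n Q)^t* *m convmx l n Q.
Proof.
elim: s H => [|a s IH] H /=; first by rewrite !big_nil.
move=> nHs; rewrite !big_cons.
have sz : (n + size (H * \prod_(a <- s) ('X - a%:P))%R <= l)%N.
  have sH : (size (H * \prod_(a <- s) ('X - a%:P))%R <= size H + size s)%N.
    by apply: leq_trans (size_polyMleq _ _) _; rewrite size_prod_XsubC addnS.
  by apply: leq_trans (leq_add (leqnn n) sH) _; rewrite addnA -ltnS -addnS.
rewrite [in LHS]mulrCA.
transitivity ((convmx l n (reflect_root a * (H * \prod_(a0 <- s) ('X - a0%:P))))^t* *m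
  convmx l n (reflect_root a * (H * \prod_(a0 <- s) ('X - a0%:P)))).
  by rewrite /reflect_root; case: ifP => // _; exact: gram_convmx_reflect.
rewrite !mulrA ![reflect_root a * H]mulrC; apply: IH.
have sH : (size (H * reflect_root a)%R <= size H + 1)%N.
  apply: leq_trans (size_polyMleq _ _) _.
  have := size_reflect_root a; case: size => [|[|[|//]]] _.
  - by rewrite addn0 (leq_trans (leq_pred _))// leq_addr.
  - by rewrite addn1/= leqnSn.
  - by rewrite addnS.
apply: leq_trans (leq_add (leq_add (leqnn n) sH) (leqnn _)) _.
by rewrite addnA -addnA add1n.
Qed.

(** The square truncations represent multiplication of polynomials modulo X^n. *)
Lemma convmxM n p q : convmx n n (p * q) = convmx n n p *m convmx n n q.
Proof.
apply/matrixP => i j; rewrite !mxE.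
under eq_bigr do rewrite !mxE.
case: leqP => ji; last first.
  rewrite big1// => k _; case: ifP => ki; rewrite ?mul0r//.
  by case: ifP => jk; rewrite ?mulr0//; move: ji ki jk; lia.
rewrite -(big_mkord xpredT (fun k => (if (k <= i)%N then p`_(i - k) else 0) *
   (if (j <= k)%N then q`_(k - j) else 0))).
have jn := ltn_ord j; have lin := ltn_ord i.
rewrite (@big_cat_nat _ _ _ j)//=; last by move: jn; lia.
rewrite big_nat big1 ?add0r => [|k /andP[_ kj]]; last by rewrite [(j <= k)%N]leqNgt kj mulr0.
rewrite (@big_cat_nat _ _ _ i.+1)//=; last by move: ji; lia.
rewrite [X in _ + X]big_nat [X in _ + X]big1 ?addr0 => [|k /andP[ik _]]; last first.
  by rewrite [(k <= i)%N]leqNgt ik mul0r.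
rewrite coefMr -[X in index_iota X]add0n big_addn subSn// big_mkord.
apply: eq_bigr => k _; have := ltn_ord k => /= ki.
rewrite addnK leq_addl (_ : (k + j <= i)%N); last by move: ki ji; lia.
by rewrite addnC subnDA.
Qed.

Lemma convmx1 n : convmx n n 1 = 1%:M.
Proof.
apply/matrixP => i j; rewrite !mxE coef1 subn_eq0 -val_eqE/=.
by case: ltngtP.
Qed.

Lemma det_convmx n p : \det (convmx n n p) = p`_0 ^+ n.
Proof.
rewrite det_trig; last by apply/is_trig_mxP => i j ij; rewrite mxE leqNgt ij.
under eq_bigr do rewrite mxE leqnn subnn.
by rewrite prodr_const card_ord.
Qed.

Lemma convmx_geometric n b :
  convmx n n (1 - b *: 'X) *m convmx n n (\poly_(k < n) b ^+ k) = 1%:M.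
Proof.
rewrite -convmxM -convmx1; apply/matrixP => i j; rewrite !mxE; case: ifP => // ji.
rewrite mulrBl mul1r -scalerAl coefB coefZ coefXM !coef_poly coef1.
have -> : (i - j < n)%N by have := ltn_ord i; lia.
case: (i - j)%N (leq_subr j i) => [|k] kn/=; first by rewrite mulr0 subr0.
have -> : (k < n)%N by have := ltn_ord i; move: kn; lia.
by rewrite -exprS subrr.
Qed.

Lemma norm_mulmx_le m n k (A : 'M[C]_(m, n)) (B : 'M[C]_(n, k)) (x y : C) :
  (forall i j, `|A i j| <= x) -> (forall i j, `|B i j| <= y) ->
  forall i j, `|(A *m B) i j| <= n%:R * (x * y).
Proof.
move=> Ax By i j; rewrite mxE; apply: le_trans (ler_norm_sum _ _ _) _.
rewrite mulr_natl -[X in _ *+ X]card_ord -sumr_const; apply: ler_sum => l _.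
by rewrite normrM; apply: ler_pM.
Qed.

(** Modulo X^n the inverse of 1 - b X is a geometric sum, with coefficients of modulus at most 1;
    each further factor therefore costs one factor n in the matrix product. *)
Lemma convmx_inverse n (t : seq C) : all (fun b => `|b| <= 1) t ->
  exists2 W : 'M[C]_n, convmx n n (\prod_(b <- t) (1 - b *: 'X)) *m W = 1%:M &
    forall i j, `|W i j| <= n%:R ^+ size t.
Proof.
elim: t => [_|b t IH /= /andP[b1 /IH[W UW Wn]]].
  exists 1%:M; first by rewrite big_nil convmx1 mulmx1.
  by move=> i j; rewrite mxE expr0; case: (_ == _); rewrite ?normr1 ?normr0.
exists (convmx n n (\poly_(k < n) b ^+ k) *m W).
  rewrite big_cons mulrC convmxM -mulmxA (mulmxA (convmx n n (1 - _))).
  by rewrite convmx_geometric mul1mx.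
have gb i j : `|convmx n n (\poly_(k < n) b ^+ k) i j| <= 1.
  rewrite mxE; case: ifP => _; last by rewrite normr0.
  by rewrite coef_poly; case: ifP => _; rewrite ?normr0// normrX exprn_ile1.
move=> i j; apply: le_trans (norm_mulmx_le gb Wn i j) _.
by rewrite mul1r exprS.
Qed.

(** Sylvester's identity, by factoring one block matrix in two ways. It trades a determinant of
    growing size for one of fixed size. *)
Lemma det_1addmx m n (A : 'M[C]_(m, n)) (B : 'M[C]_(n, m)) :
  \det (1%:M + A *m B) = \det (1%:M + B *m A).
Proof.
have e1 : block_mx 1%:M (- B) A 1%:M =
    block_mx 1%:M 0 A 1%:M *m block_mx 1%:M (- B) 0 (1%:M + A *m B).
  rewrite mulmx_block !mul1mx !mul0mx !mulmx1 !addr0 mulmxN.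
  by congr block_mx; rewrite addrC addrK.
have e2 : block_mx 1%:M (- B) A 1%:M =
    block_mx (1%:M + B *m A) (- B) 0 1%:M *m block_mx 1%:M 0 A 1%:M.
  rewrite mulmx_block !mul1mx !mul0mx !mulmx1 !mulmx0 !add0r mulNmx.
  by congr block_mx; rewrite addrK.
have := congr1 determinant e1; rewrite {1}e2 !det_mulmx !det_ublock !det_lblock !det1.
by rewrite !mulr1 !mul1r.
Qed.

(** In a unitary eigenbasis P the diagonal matrix is 1 + (P X)(P X)^H, so each eigenvalue is 1 plus
    a sum of squared moduli. *)
Lemma det_1addXXs_ge1 m n (X : 'M[C]_(m, n)) : 1 <= \det (1%:M + X *m X^t*).
Proof.
set A := _ + _.
have hA : A^t* = A.
  rewrite /A linearD/= map_mxD trmx1 map_scalar_mx/= rmorph1 trmx_mul map_mxM.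
  by rewrite trmxCK.
have nA : A \is normalmx by apply/normalmxP; rewrite hA.
have /orthomx_spectralP AE := nA.
set P := spectralmx A in AE; set D := spectral_diag A in AE.
have uP : P \is unitarymx by exact: spectral_unitarymx.
have PP : P *m P^t* = 1%:M by exact/unitarymxP.
have DE : diag_mx D = 1%:M + (P *m X) *m (P *m X)^t*.
  have : P *m A *m P^t* = diag_mx D.
    rewrite AE (invmx_unitary uP) !mulmxA PP mul1mx -mulmxA PP mulmx1 //.
  move=> <-; rewrite /A mulmxDr mulmx1 mulmxDl PP; congr (_ + _).
  by rewrite trmx_mul map_mxM !mulmxA.
have D1 i : 1 <= D 0 i.
  have /matrixP/(_ i i) := DE; rewrite !mxE eqxx mulr1n => ->.
  rewrite lerDl; apply: sumr_ge0 => k _.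
  by rewrite [(_ ^t*) _ _]mxE [_^T _ _]mxE mul_conjC_ge0.
rewrite AE !det_mulmx det_inv mulrC mulrA divff; last first.
  by rewrite -unitfE -unitmxE unitarymx_unit.
rewrite mul1r det_diag.
elim/big_ind : _ => // x y x1 y1; exact: mulr_ege1.
Qed.

Lemma norm_det_le m (A : 'M[C]_m) (x : C) :
  (forall i j, `|A i j| <= x) -> `|\det A| <= m`!%:R * x ^+ m.
Proof.
move=> Ax; apply: le_trans (ler_norm_sum _ _ _) _.
rewrite mulr_natl -perm.card_Sn -sumr_const; apply: ler_sum => s _.
rewrite normrM normrX normrN1 expr1n mul1r normr_prod.
rewrite -[X in _ ^+ X]card_ord -prodr_const; apply: ler_prod => i _.
by rewrite normr_ge0 Ax.
Qed.

End toeplitz.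

(** * Two-sided bounds for the Gram determinant *)

Section gram_growth.
Local Open Scope sesquilinear_scope.
Context {C : numClosedFieldType}.

Lemma trmxC_mul m n k (A : 'M[C]_(m, n)) (B : 'M[C]_(n, k)) :
  (A *m B)^t* = B^t* *m A^t*.
Proof. by rewrite trmx_mul map_mxM. Qed.

Lemma gram_convmx_bounds (m : nat) (q0 : C) (t : seq C) :
  q0 != 0 -> all (fun b => `|b| <= 1) t ->
  let Q := q0 *: \prod_(b <- t) (1 - b *: 'X) in
  exists c : C, exists e : nat, 0 <= c /\ forall n : nat, (0 < n)%N ->
    let D := \det ((convmx (n + m) n Q)^t* *m convmx (n + m) n Q) in
    `|q0| ^+ (2 * n) <= D /\ D <= `|q0| ^+ (2 * n) * (c * n%:R ^+ e).
Proof.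
move=> q00 t1 Q.
pose q := \sum_(i < size Q) `|Q`_i|.
have Qq i : `|Q`_i| <= q.
  have [iQ|Qi] := ltnP i (size Q); last first.
    by rewrite nth_default// normr0 sumr_ge0.
  by rewrite /q (bigD1 (Ordinal iQ))//= lerDl sumr_ge0.
have q_ge0 : 0 <= q by exact: sumr_ge0.
pose A := q * `|q0^-1|.
have A0 : 0 <= A by rewrite mulr_ge0.
pose k := size t.
(* With k factors the entries of U^-1 are O(n^k), those of X = V U^-1 are O(n^(k+1)), and those of X
   X^H are O(n^(2k+3)), each product adding one n. The Leibniz formula in size m raises this to the
   power m and contributes m!. *)
exists (m`!%:R * (1 + A ^+ 2) ^+ m), (((2 * k + 3) * m)%N).
split; first by rewrite mulr_ge0 ?ler0n// exprn_ge0// addr_ge0// exprn_ge0.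
move=> n n0 D.
have n1 : 1 <= n%:R :> C by rewrite ler1n.
have n_ge0 : 0 <= n%:R :> C by rewrite ler0n.
pose U := convmx n n Q.
pose V : 'M[C]_(m, n) := \matrix_(i, j) Q`_(n + i - j).
have [W0 UW0 W0n] := convmx_inverse n t1.
pose W := q0^-1 *: W0.
have UW : U *m W = 1%:M.
  by rewrite /U /W /Q convmxZ -scalemxAl -scalemxAr scalerA mulfV// scale1r.
have WU : W *m U = 1%:M by exact: mulmx1C.
have GE : convmx (n + m) n Q = col_mx U V.
  apply/matrixP => i j; rewrite mxE; have [i' ->|i' ->] := split_ordP i.
    by rewrite col_mxEu mxE.
  by rewrite col_mxEd mxE /= (leq_trans (ltnW (ltn_ord j)) (leq_addr _ _)).
pose X := V *m W.
have VE : V = X *m U by rewrite /X -mulmxA WU mulmx1.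
have DE : D = `|q0| ^+ (2 * n) * \det (1%:M + X *m X^t*).
  have GG : (convmx (n + m) n Q)^t* *m convmx (n + m) n Q =
      U^t* *m (1%:M + X^t* *m X) *m U.
    rewrite GE tr_col_mx map_row_mx mul_row_col {1 2}VE trmxC_mul.
    by rewrite mulmxDr mulmx1 mulmxDl !mulmxA.
  rewrite /D GG !det_mulmx det_1addmx mulrAC; congr (_ * _).
  rewrite det_map_mx det_tr /U det_convmx.
  have -> : Q`_0 = q0.
    rewrite /Q coefZ -horner_coef0 horner_prod big1 ?mulr1// => b _.
    by rewrite !hornerE ?(mulr0, subr0).
  by rewrite exprM normCK mulrC exprMn rmorphXn.
have X1 := det_1addXXs_ge1 X.
have q0n : 0 <= `|q0| ^+ (2 * n) by exact: exprn_ge0.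
rewrite DE; split; first by rewrite ler_peMr.
apply: ler_wpM2l => //.
rewrite -[\det _]ger0_norm; last exact: le_trans X1.
have Vq i j : `|V i j| <= q by rewrite mxE.
have Wb i j : `|W i j| <= `|q0^-1| * n%:R ^+ k.
  by rewrite mxE normrM ler_wpM2l.
pose x := A * n%:R ^+ k.+1.
have Xb i j : `|X i j| <= x.
  apply: le_trans (norm_mulmx_le Vq Wb i j) _.
  by rewrite /x /A exprS le_eqVlt; apply/orP; left; apply/eqP; ring.
have Xbs i j : `|X^t* i j| <= x by rewrite mxE norm_conjC mxE.
have Yb i j : `|(1%:M + X *m X^t*) i j| <= (1 + A ^+ 2) * n%:R ^+ (2 * k + 3).
  rewrite mxE; apply: le_trans (ler_normD _ _) _.
  rewrite mulrDl mul1r; apply: lerD.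
    rewrite mxE; apply: (@le_trans _ _ 1); last exact: exprn_ege1.
    by case: (_ == _); rewrite ?normr1 ?normr0.
  apply: le_trans (norm_mulmx_le Xb Xbs i j) _.
  rewrite le_eqVlt; apply/orP; left; apply/eqP.
  rewrite /x (_ : (2 * k + 3 = (k.+1 + k.+1).+1)%N); last by lia.
  by rewrite (exprS _ (k.+1 + k.+1)) (exprD _ k.+1 k.+1); ring.
apply: le_trans (norm_det_le Yb) _.
by rewrite exprMn -exprM mulrA.
Qed.

End gram_growth.

Lemma reflect_rootE (C : numClosedFieldType) (a : C) :
  reflect_root a = (if 1 <= `|a| then - a else 1) *:
    (1 - (if 1 <= `|a| then a^-1 else a^*) *: 'X).
Proof.
rewrite /reflect_root; case: ifPn => [a1|_]; last by rewrite scale1r.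
have a0 : a != 0 by rewrite -normr_gt0 (lt_le_trans ltr01).
by rewrite scalerBr scalerA mulNr mulfV// scaleN1r opprK addrC scaleNr alg_polyC.
Qed.

(** * Transfer of the bounds to the real matrix of the filter *)

Section gmat.
Local Open Scope sesquilinear_scope.
Context {R : realType}.
Implicit Types (g : nat -> R) (eta n : nat).
Local Notation toC := (@real_complex R).

(** The norm on [R[i]] takes values in [R[i]]; this is the same number seen in [R]. *)
Definition cmod (z : R[i]) : R := complex.Re `|z|.

Lemma cmodE z : toC (cmod z) = `|z|.
Proof. by rewrite /cmod RRe_real// normr_real. Qed.

(** The transfer function as a polynomial in z^-1. At e^{iw} it is the conjugate of G(e^{iw}), the
    coefficients being real, so the modulus is the same. *)
Definition gpoly g eta : {poly R[i]} := \poly_(k < eta.+1) toC (g k).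

(** The Mahler measure of the polynomial c prod (X - a). *)
Definition mahler (c : R[i]) (s : seq R[i]) : R :=
  cmod c * \prod_(a <- s) Num.max 1 (cmod a).

Lemma det_Gmat_bounds g eta c (s : seq R[i]) :
  c != 0 -> gpoly g eta = c *: \prod_(a <- s) ('X - a%:P) ->
  exists K : R, exists e : nat, 0 <= K /\ forall n, (0 < n)%N ->
    let D := \det ((Gmat g eta n)^T *m Gmat g eta n) in
    mahler c s ^+ (2 * n) <= D /\ D <= mahler c s ^+ (2 * n) * (K * n%:R ^+ e).
Proof.
move=> c0 gE.
pose h a : R[i] := if 1 <= `|a| then - a else 1.
pose b (a : R[i]) : R[i] := if 1 <= `|a| then a^-1 else a^*.
pose q0 := c * \prod_(a <- s) h a.
have h0 a : h a != 0.
  rewrite /h; case: ifPn => [a1|_]; last exact: oner_neq0.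
  by rewrite oppr_eq0 -normr_gt0 (lt_le_trans ltr01).
have q00 : q0 != 0.
  by rewrite mulf_neq0// prodf_seq_neq0; apply/allP => a _; rewrite h0.
have q0M : `|q0| = toC (mahler c s).
  rewrite normrM normr_prod /mahler rmorphM/= cmodE rmorph_prod; congr (_ * _).
  apply: eq_bigr => a _; rewrite /h; case: ifPn => a1.
    rewrite normrN -cmodE; congr toC; apply/esym/max_idPr.
    by rewrite -lecR cmodE.
  rewrite normr1; congr toC; apply/esym/max_idPl.
  by rewrite -lecR cmodE ltW// real_ltNge ?real1 ?normr_real.
have bs : all (fun x => `|x| <= 1) (map b s).
  apply/allP => _ /mapP[a _ ->]; rewrite /b; case: ifPn => [a1|].
    by rewrite normfV invf_le1// (lt_le_trans ltr01).
  by rewrite norm_conjC -real_ltNge ?real1 ?normr_real// => /ltW.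
have QE : c%:P * \prod_(a <- s) reflect_root a = q0 *: \prod_(x <- map b s) (1 - x *: 'X).
  rewrite mul_polyC big_map (eq_bigr _ (fun a _ => reflect_rootE a)).
  by rewrite scaler_prod scalerA.
(* Degree at most eta is what makes n + eta rows enough for the reflection of all roots. *)
have szs : (size s <= eta)%N.
  have : (size (gpoly g eta) <= eta.+1)%N by exact: size_poly.
  by rewrite gE size_scale// size_prod_XsubC.
have [K [e [K0 HK]]] := gram_convmx_bounds eta q00 bs.
exists (complex.Re K), e.
have KE : K = toC (complex.Re K) by rewrite RRe_real// ger0_real.
split; first by rewrite -lecR -KE.
move=> n n0 D.
have DE : toC D = \det ((convmx (n + eta) n (q0 *: \prod_(x <- map b s) (1 - x *: 'X)))^t* *m
    convmx (n + eta) n (q0 *: \prod_(x <- map b s) (1 - x *: 'X))).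
  rewrite -QE -gram_convmx_reflect_prod.
    rewrite mul_polyC -gE /D -det_map_mx map_mxM -map_trmx.
    have -> : map_mx toC (Gmat g eta n) = convmx (n + eta) n (gpoly g eta).
      apply/matrixP => i j; rewrite !mxE /gcoef coef_poly.
      by case: ifP; rewrite ?rmorph0// ltnS; case: ifP.
    congr (\det (_ *m _)); apply/matrixP => i j; rewrite !mxE.
    case: ifP => _; last by rewrite conjC0.
    rewrite /gcoef coef_poly ltnS; case: ifP => _; last by rewrite !rmorph0.
    by apply/esym; etransitivity; [apply: conj_Creal; rewrite complex_real|].
  rewrite size_polyC c0 addn1 addSn ltnS; exact: leq_add.
have [h1 h2] := HK n n0; rewrite -DE in h1 h2; split.
  by rewrite -lecR rmorphXn/= -q0M.
by rewrite -lecR !rmorphM !rmorphXn/= rmorph_nat -q0M -KE.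
Qed.

Lemma mahler_gt0 c s : c != 0 -> 0 < mahler c s.
Proof.
move=> c0; rewrite mulr_gt0//; first by rewrite -ltcR cmodE normr_gt0.
by apply: prodr_gt0 => a _; rewrite lt_max ltr01.
Qed.

End gmat.

(** * Jensen's formula on the unit circle *)

Section circle_integrals.
Context {R : realType}.
Local Notation mu := (@lebesgue_measure R).
Local Notation pi := (@pi R).

Section periodic.
Variable F : R -> \bar R.
Hypothesis mF : measurable_fun setT F.
Hypothesis F0 : forall x, (0 <= F x)%E.
Local Open Scope ereal_scope.

Lemma ge0_integral_itv_affine (a b x y : R) : (0 < a)%R ->
  a%:E * \int[mu]_(w in `]x, y]) F (a * w + b)%R =
  \int[mu]_(w in `](a * x + b)%R, (a * y + b)%R]) F w.
Proof.
move=> a0; rewrite [RHS]integral_mkcond.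
rewrite -(@ge0_integral_affine _ a b)//; last 3 first.
- by rewrite gt_eqF.
- by apply/(measurable_restrictT _ _).1 => //; exact: measurable_funS mF.
- by move=> w; rewrite patchE; case: ifP.
rewrite gtr0_norm// integral_mkcond; congr (_ * _); apply: eq_integral => w _.
rewrite !patchE; congr (if _ then _ else _).
by apply/idP/idP; rewrite !inE/= !in_itv/= ltrD2r lerD2r ltr_pM2l// ler_pM2l.
Qed.

Lemma ge0_integral_itvU (x y z : R) : (x <= y)%R -> (y <= z)%R ->
  \int[mu]_(w in `]x, z]) F w = \int[mu]_(w in `]x, y]) F w + \int[mu]_(w in `]y, z]) F w.
Proof.
move=> xy yz; rewrite (@itv_bndbnd_setU _ _ _ (BRight y)) ?bnd_simp//.
rewrite ge0_integral_setU//; first exact: measurable_funS mF.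
apply/disj_setPS => w /= []; rewrite !in_itv/= => /andP[_ wy] /andP[yw _].
by move: wy; rewrite leNgt yw.
Qed.

Hypothesis FP : forall x, F (x + pi *+ 2)%R = F x.

Lemma periodic_integral_shift (x y : R) :
  \int[mu]_(w in `](x + pi *+ 2)%R, (y + pi *+ 2)%R]) F w = \int[mu]_(w in `]x, y]) F w.
Proof.
have := @ge0_integral_itv_affine 1 (pi *+ 2)%R x y ltr01.
rewrite !mul1r mul1e => <-; apply: eq_integral => w _.
by rewrite mul1r FP.
Qed.

(** Translation by half a period exchanges the two halves of the circle. *)
Lemma periodic_integral_pi :
  \int[mu]_(w in `](- pi)%R, pi]) F (w + pi)%R = \int[mu]_(w in `](- pi)%R, pi]) F w.
Proof.
have pi0 := @pi_ge0 R.
have := @ge0_integral_itv_affine 1 pi (- pi)%R pi ltr01.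
rewrite !mul1r mul1e addNr; under eq_integral do rewrite mul1r.
move=> ->; rewrite (@ge0_integral_itvU 0 pi)//; last by rewrite lerDl.
rewrite (@ge0_integral_itvU (- pi) 0 pi)// ?oppr_le0// addeC; congr (_ + _).
rewrite -[RHS]periodic_integral_shift add0r.
have -> : (- pi + pi *+ 2 = pi)%R by rewrite mulr2n; lra.
by rewrite mulr2n.
Qed.

(** Doubling the angle covers the circle twice, which the Jacobian 2 compensates. The outer pieces
    ]-2 pi, - pi] and ]pi, 2 pi] are moved by a period onto ]0, pi] and ]- pi, 0]. *)
Lemma periodic_integral_double :
  \int[mu]_(w in `](- pi)%R, pi]) F (2 * w)%R = \int[mu]_(w in `](- pi)%R, pi]) F w.
Proof.
have pi0 := @pi_ge0 R.
have two0 : (0 < 2 :> R)%R by [].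
have := @ge0_integral_itv_affine 2 0 (- pi)%R pi two0.
under eq_integral do rewrite addr0.
rewrite !addr0.
set I := \int[mu]_(w in `](- pi)%R, pi]) F w.
suff -> : \int[mu]_(w in `](2 * - pi)%R, (2 * pi)%R]) F w = 2%:E * I.
  move=> /(congr1 (mule (2^-1)%:E)).
  by rewrite !muleA -!EFinM mulVf ?pnatr_eq0// !mul1e.
rewrite (@ge0_integral_itvU _ (- pi)%R); [|lra|lra].
rewrite (@ge0_integral_itvU _ pi (2 * pi))%R; [|lra|lra].
rewrite -(@periodic_integral_shift (2 * - pi) (- pi))%R.
have -> : (2 * - pi + pi *+ 2 = 0)%R by rewrite mulr2n; lra.
have -> : (2 * pi = 0 + pi *+ 2)%R by rewrite mulr2n; lra.
have piE : (- pi + pi *+ 2 = pi)%R by rewrite mulr2n; lra.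
rewrite -[X in `]X, (0 + _)%R]]piE periodic_integral_shift piE.
rewrite addeCA [X in _ + X]addeC -(@ge0_integral_itvU (- pi) 0 pi)// ?oppr_le0// -/I.
by rewrite -mule2n mule_natl.
Qed.

End periodic.
End circle_integrals.

(** * The logarithmic mean for a point of the closed unit disc *)

Section jensen.
Context {R : realType}.
Local Notation mu := (@lebesgue_measure R).
Local Notation pi := (@pi R).
Implicit Types x y w : R.

(* |e^{iw} - (x + iy)|^2 *)
Definition dist2 x y w : R := (cos w - x) ^+ 2 + (sin w - y) ^+ 2.

Lemma dist2_ge0 x y w : 0 <= dist2 x y w.
Proof. by rewrite addr_ge0// sqr_ge0. Qed.

Lemma dist2E x y w : dist2 x y w = 1 - 2 * (cos w * x + sin w * y) + (x ^+ 2 + y ^+ 2).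
Proof. by have := cos2Dsin2 w; rewrite /dist2; nra. Qed.

Lemma cos_sin_cauchy x y w : (cos w * x + sin w * y) ^+ 2 <= x ^+ 2 + y ^+ 2.
Proof.
have := cos2Dsin2 w; set c := cos w; set s := sin w => cs.
have -> : (c * x + s * y) ^+ 2 =
    (c ^+ 2 + s ^+ 2) * (x ^+ 2 + y ^+ 2) - (c * y - s * x) ^+ 2 by ring.
by rewrite cs mul1r gerBl sqr_ge0.
Qed.

Lemma dist2_bounds x y w (r : R) : 0 <= r -> x ^+ 2 + y ^+ 2 = r ^+ 2 ->
  (1 - r) ^+ 2 <= dist2 x y w /\ dist2 x y w <= (1 + r) ^+ 2.
Proof.
move=> r0 xyr; have := cos_sin_cauchy x y w; rewrite dist2E xyr.
set t := _ + _ => tr.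
have : `|t| <= r by rewrite -(@ler_pXn2r _ 2)// ?nnegrE// real_normK ?num_real.
by rewrite ler_norml => /andP[? ?]; split; nra.
Qed.

Lemma measurable_dist2 x y : measurable_fun setT (dist2 x y).
Proof.
have mc : measurable_fun setT (fun w : R => cos w).
  by apply: continuous_measurable_fun => ?; exact: continuous_cos.
have ms : measurable_fun setT (fun w : R => sin w).
  by apply: continuous_measurable_fun => ?; exact: continuous_sin.
by apply: measurable_funD; apply: measurable_funX; exact: measurable_funB.
Qed.

(* Nonnegative when |x + iy| <= 1, so its integrals can be manipulated before
   ln (dist2 x y) is known to be integrable. *)
Definition gap x y w : \bar R := (ln 4 - ln (dist2 x y w))%:E.

Lemma measurable_gap x y : measurable_fun setT (gap x y).
Proof.
apply/measurable_EFinP; apply: measurable_funB => //.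
exact: (measurableT_comp (@measurable_ln R) (measurable_dist2 x y)).
Qed.

Lemma gap_ge0 x y w : x ^+ 2 + y ^+ 2 <= 1 -> (0 <= gap x y w)%E.
Proof.
move=> xy1; rewrite lee_fin subr_ge0.
(* At a zero of [dist2] the convention ln 0 = 0 still stays below ln 4. Elsewhere 4 comes from the
   distance of two points of the disc being at most 2. *)
have [d0|d0] := leP (dist2 x y w) 0; first by rewrite ln0// ln_ge0// ler1n.
rewrite ler_ln ?posrE//.
pose r := Num.sqrt (x ^+ 2 + y ^+ 2).
have xyr : x ^+ 2 + y ^+ 2 = r ^+ 2 by rewrite sqr_sqrtr// addr_ge0// sqr_ge0.
have r0 : 0 <= r by exact: sqrtr_ge0.
have r1 : r <= 1 by rewrite -(@ler_pXn2r _ 2)// ?nnegrE// expr1n -xyr.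
have [_ /le_trans] := dist2_bounds w r0 xyr; apply.
by nra.
Qed.

Lemma gap_periodic x y w : gap x y (w + pi *+ 2) = gap x y w.
Proof. by rewrite /gap /dist2 cosD2pi sinD2pi. Qed.

Lemma gap_opp x y w : gap (- x) (- y) w = gap x y (w + pi).
Proof.
rewrite /gap /dist2 cosDpi sinDpi; congr (_ - ln _)%:E.
by rewrite -opprD sqrrN -[X in _ + X]sqrrN; congr (_ + _ ^+ 2); ring.
Qed.

(** The new parameters are the real and imaginary parts of (x + iy)^2. *)
Lemma dist2_double x y w :
  dist2 (x ^+ 2 - y ^+ 2) (2 * x * y) (2 * w) = dist2 x y w * dist2 (- x) (- y) w.
Proof.
rewrite /dist2 !mulrDl !mul1r cosD sinD; set c := cos w; set s := sin w; ring.
Qed.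

(** Half-open, so that its translates by 2 pi tile the line. *)
Definition circ : set R := `](- pi)%R, pi]%classic.

Lemma measurable_circ : measurable circ. Proof. exact: measurable_itv. Qed.

Lemma cos_level_negligible x : exists N : set R,
  [/\ measurable N, mu N = 0%E & forall w, circ w -> cos w = x -> N w].
Proof.
exists [set acos x; - acos x]; split.
- by apply: measurableU.
- by rewrite countable_lebesgue_measure0//; exact/finite_set_countable/finite_set2.
- move=> w; rewrite /circ/= in_itv/= => /andP[w1 w2] <-.
  have [w0|w0] := leP 0 w; first by left; rewrite cosK// in_itv/= w0.
  by right; rewrite -cosN cosK ?opprK// in_itv/= oppr_ge0 ltW//= lerNl ltW.
Qed.

Lemma ae_dist2_gt0 x y : {ae mu, forall w, circ w -> 0 < dist2 x y w}.
Proof.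
have [N [mN N0 HN]] := cos_level_negligible x.
exists N; split => // w /= h; apply: contrapT => Nw; apply: h => cw.
rewrite lt_def dist2_ge0 andbT; apply/eqP => d0; apply: Nw; apply: HN => //.
by move/eqP : d0; rewrite paddr_eq0 ?sqr_ge0// !sqrf_eq0 !subr_eq0 => /andP[/eqP].
Qed.

Local Open Scope ereal_scope.

Lemma integral_circ_cst (k : R) : \int[mu]_(w in circ) k%:E = (k * (2 * pi))%:E.
Proof.
rewrite integral_cst /circ//= lebesgue_measure_itv/= lte_fin.
have pi0 := @pi_gt0 R; rewrite (_ : (- pi < pi)%R); last by lra.
by rewrite -EFinB -EFinM; congr EFin; ring.
Qed.

(** Write J(a) for the integral of the gap and L = 2 pi ln 4. Off the zeros of [dist2] the gap of
    a^2 plus ln 4 is the gap of a plus that of -a, and J(-a) = J(a) by half a turn. Hence J(a^2) - L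
    = 2 (J(a) - L). *)
Lemma gap_double x y : (x ^+ 2 + y ^+ 2 <= 1)%R ->
  \int[mu]_(w in circ) gap (x ^+ 2 - y ^+ 2) (2 * x * y) w + (ln 4 * (2 * pi))%:E =
  \int[mu]_(w in circ) gap x y w + \int[mu]_(w in circ) gap x y w.
Proof.
move=> xy1; set x2 := (_ - _)%R; set y2 := (_ * _ * _)%R.
have xy2 : (x2 ^+ 2 + y2 ^+ 2 <= 1)%R.
  have -> : (x2 ^+ 2 + y2 ^+ 2 = (x ^+ 2 + y ^+ 2) ^+ 2)%R by rewrite /x2 /y2; ring.
  by rewrite exprn_ile1// addr_ge0// sqr_ge0.
have xyN : ((- x) ^+ 2 + (- y) ^+ 2 <= 1)%R by rewrite !sqrrN.
have mg u v D : measurable_fun D (gap u v) by apply: measurable_funS (measurable_gap u v).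
have mc := measurable_circ.
rewrite -[X in X + _ = _](periodic_integral_double (measurable_gap x2 y2)
  (fun w => gap_ge0 w xy2) (gap_periodic x2 y2)).
rewrite -[X in _ = _ + X](periodic_integral_pi (measurable_gap x y)
  (fun w => gap_ge0 w xy1) (gap_periodic x y)).
have m2 : measurable_fun setT (fun w : R => gap x2 y2 (2 * w)%R).
  by apply: (measurableT_comp (measurable_gap _ _)); exact: mulrl_measurable.
have mpi : measurable_fun circ (fun w : R => gap x y (w + pi)%R).
  rewrite (_ : (fun _ => _) = gap (- x) (- y)); first exact: mg.
  by apply/funext => w; rewrite gap_opp.
have l4 : (0 <= ln (4 : R))%R by rewrite ln_ge0// ler1n.
rewrite -integral_circ_cst -!ge0_integralD//; last 5 first.
- by move=> w _; exact: gap_ge0.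
- exact: mg.
- by move=> w _; exact: gap_ge0.
- by move=> w _; exact: gap_ge0.
- exact: measurable_funS m2.
apply: ge0_ae_eq_integral => //.
- by apply: emeasurable_funD => //; exact: measurable_funS m2.
- by apply: emeasurable_funD => //; exact: mg.
- by move=> w _; apply: adde_ge0; [exact: gap_ge0|rewrite lee_fin].
- by move=> w _; apply: adde_ge0; exact: gap_ge0.
apply: (filterS2 (ae_filter_ringOfSetsType mu) _ (ae_dist2_gt0 x y)
  (ae_dist2_gt0 (- x) (- y))).
move=> w d1 d2 cw; rewrite -gap_opp /gap dist2_double lnM ?posrE ?d1 ?d2//.
by rewrite -!EFinD; congr EFin; ring.
Qed.

Lemma gap_iter (k : nat) x y (i : R) : (x ^+ 2 + y ^+ 2 <= 1)%R ->
  \int[mu]_(w in circ) gap x y w = i%:E ->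
  exists x' y', [/\ (x' ^+ 2 + y' ^+ 2 = (x ^+ 2 + y ^+ 2) ^+ (2 ^ k))%R &
    \int[mu]_(w in circ) gap x' y' w =
      (2 ^+ k * (i - ln 4 * (2 * pi)) + ln 4 * (2 * pi))%:E].
Proof.
move=> xy1 Ii; elim: k => [|k [x' [y' [xy' I']]]].
  by exists x, y; rewrite expr0 mul1r subrK expr1.
have xy'1 : (x' ^+ 2 + y' ^+ 2 <= 1)%R.
  by rewrite xy' exprn_ile1// addr_ge0// sqr_ge0.
exists (x' ^+ 2 - y' ^+ 2)%R, (2 * x' * y')%R; split.
  by rewrite expnS mulnC exprM -xy'; ring.
have := gap_double xy'1; rewrite I'.
case: (\int[_]_(_ in _) _) => [j| |]//=; rewrite -!EFinD => -[] jE.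
by congr EFin; rewrite exprS; lra.
Qed.

Lemma exp2_bounded_le0 (e B : R) : (forall k : nat, 2 ^+ k * e <= B)%R -> (e <= 0)%R.
Proof.
move=> h; rewrite leNgt; apply/negP => e0.
pose k := Num.bound (`|B| / e); have := h k; rewrite leNgt => /negP; apply.
apply: (le_lt_trans (ler_norm _)); rewrite -ltr_pdivrMr//.
apply: (lt_le_trans (archi_boundP _)); first by rewrite divr_ge0// ltW.
by rewrite -natrX ler_nat ltnW// ltn_expl.
Qed.

(** Iterated squaring multiplies the deviation from 2 pi ln 4 by 2^k, while gap integrals stay
    nonnegative; a negative deviation is impossible. *)
Lemma gap_ge x y (i : R) : (x ^+ 2 + y ^+ 2 <= 1)%R ->
  \int[mu]_(w in circ) gap x y w = i%:E -> (ln 4 * (2 * pi) <= i)%R.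
Proof.
move=> xy1 Ii; rewrite -subr_le0.
apply: (@exp2_bounded_le0 _ (ln 4 * (2 * pi))%R) => k.
have [x' [y' [xy' I']]] := gap_iter k xy1 Ii.
have : 0 <= \int[mu]_(w in circ) gap x' y' w.
  apply: integral_ge0 => w _; apply: gap_ge0.
  by rewrite xy' exprn_ile1// addr_ge0// sqr_ge0.
by rewrite I' lee_fin; nra.
Qed.

(** Squares of a point of modulus r < 1 stay within radius r, where [dist2] is at least (1 - r)^2.
    This bounds all the iterated gap integrals from above and excludes a positive deviation. *)
Lemma gap_lt1 x y : (x ^+ 2 + y ^+ 2 < 1)%R ->
  \int[mu]_(w in circ) gap x y w = (ln 4 * (2 * pi))%:E.
Proof.
move=> xy1; pose q := (x ^+ 2 + y ^+ 2)%R; have xy1' := ltW xy1.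
pose r := Num.sqrt q; pose B : R := (ln 4 - ln ((1 - r) ^+ 2))%R.
have q0 : (0 <= q)%R by rewrite addr_ge0// sqr_ge0.
have r0 : (0 <= r)%R by exact: sqrtr_ge0.
have rq : (r ^+ 2 = q)%R by rewrite sqr_sqrtr.
have r1 : (r < 1)%R by rewrite -(@ltr_pXn2r _ 2)// ?nnegrE// expr1n rq.
have r10 : (0 < (1 - r) ^+ 2)%R by rewrite exprn_gt0// subr_gt0.
have bnd x' y' : (x' ^+ 2 + y' ^+ 2 <= q)%R ->
    \int[mu]_(w in circ) gap x' y' w <= (B * (2 * pi))%:E.
  move=> xy'; rewrite -integral_circ_cst; apply: ge0_le_integral => //.
  - exact: measurable_circ.
  - by move=> w _; apply: gap_ge0; exact: le_trans xy1'.
  - exact: measurable_funS (measurable_gap _ _).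
  move=> w _; rewrite lee_fin lerD2l lerN2.
  pose r' := Num.sqrt (x' ^+ 2 + y' ^+ 2).
  have r'0 : (0 <= r')%R by exact: sqrtr_ge0.
  have r'E : (x' ^+ 2 + y' ^+ 2 = r' ^+ 2)%R by rewrite sqr_sqrtr// addr_ge0// sqr_ge0.
  have r'r : (r' <= r)%R by rewrite -(@ler_pXn2r _ 2)// ?nnegrE// rq -r'E.
  have [d1 _] := dist2_bounds w r'0 r'E.
  have d2 : ((1 - r) ^+ 2 <= dist2 x' y' w)%R by apply: le_trans d1; nra.
  by rewrite ler_ln ?posrE// (lt_le_trans r10).
have := bnd _ _ (lexx q); have : 0 <= \int[mu]_(w in circ) gap x y w.
  by apply: integral_ge0 => w _; exact: gap_ge0.
case Ii : (\int[mu]_(w in circ) gap x y w) => [i| |]// _ _; congr EFin.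
apply/eqP; rewrite eq_le (gap_ge xy1' Ii) andbT -subr_le0.
apply: (@exp2_bounded_le0 _ (B * (2 * pi) - ln 4 * (2 * pi))%R) => k.
have [x' [y' [xy' I']]] := gap_iter k xy1' Ii.
have : \int[mu]_(w in circ) gap x' y' w <= (B * (2 * pi))%:E.
  by apply: bnd; rewrite xy' -/q -[leRHS]expr1 ler_wiXn2l// ?expn_gt0// ltW.
by rewrite I' lee_fin; lra.
Qed.

(** The gap is unbounded here, so Fatou's lemma along radii increasing to 1 supplies the upper
    bound. It also shows finiteness, which the lower bound [gap_ge] presupposes. *)
Lemma gap_eq1 x y : (x ^+ 2 + y ^+ 2 = 1)%R ->
  \int[mu]_(w in circ) gap x y w = (ln 4 * (2 * pi))%:E.
Proof.
move=> xy1; have xy1' : (x ^+ 2 + y ^+ 2 <= 1)%R by rewrite xy1.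
have mc := measurable_circ.
suff : \int[mu]_(w in circ) gap x y w <= (ln 4 * (2 * pi))%:E.
  have : 0 <= \int[mu]_(w in circ) gap x y w.
    by apply: integral_ge0 => w _; exact: gap_ge0.
  case Ii : (\int[mu]_(w in circ) gap x y w) => [i| |]// _.
  rewrite lee_fin => iL; congr EFin; apply/eqP.
  by rewrite eq_le iL (gap_ge xy1' Ii).
pose r (n : nat) : R := (1 - n.+2%:R^-1)%R.
have r0 n : (0 <= r n)%R by rewrite subr_ge0 invf_le1 ?ltr0n// ler1n.
have r1 n : (r n < 1)%R by rewrite ltrBlDr ltrDl invr_gt0 ltr0n.
have rxy n : ((r n * x) ^+ 2 + (r n * y) ^+ 2 < 1)%R.
  by rewrite !exprMn -mulrDr xy1 mulr1 exprn_ilt1.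
have rcvg : r n @[n --> \oo] --> (1 : R)%R.
  rewrite -[X in _ --> X]subr0; apply: cvgB; first exact: cvg_cst.
  have := @cvg_harmonic R; rewrite -(cvg_shiftS _); exact.
(* Continuity of ln, hence pointwise convergence, is used only off the zeros of [dist2]; they are
   removed beforehand. *)
have [N [mN N0 HN]] := ae_dist2_gt0 x y.
have mcN : measurable (circ `\` N) by exact: measurableD.
have sub : circ `\` N `<=` circ by move=> w [].
have gapN u v : (u ^+ 2 + v ^+ 2 <= 1)%R ->
    \int[mu]_(w in circ) gap u v w = \int[mu]_(w in circ `\` N) gap u v w.
  move=> uv; apply: ge0_negligible_integral => //.
  - exact: measurable_funS (measurable_gap _ _).
  - by move=> w _; exact: gap_ge0.
rewrite gapN//.
have -> : \int[mu]_(w in circ `\` N) gap x y w =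
    \int[mu]_(w in circ `\` N) limn_einf (fun n => gap (r n * x)%R (r n * y)%R w).
  apply: eq_integral => w; rewrite inE => -[cw Nw].
  have dw : (0 < dist2 x y w)%R by apply: contrapT => dw; apply: Nw; apply: HN => /(_ cw).
  apply/esym; apply: (cvg_limn_einf_sup _).1.
  apply/fine_cvgP; split; first exact: nearW.
  apply: cvgB; first exact: cvg_cst.
  apply: (@cvg_comp _ _ _ (fun n => dist2 (r n * x) (r n * y) w) (@ln R) \oo _ _ _
    (continuous_ln dw)).
  have cr (z : R) : ((r n * z) @[n --> \oo] --> z)%R.
    by rewrite -[X in _ --> X]mul1r; apply: cvgM => //; exact: cvg_cst.
  apply: cvgD; apply: cvgM; apply: cvgB; by [exact: cvg_cst|exact: cr].
pose G n w := gap (r n * x)%R (r n * y)%R w.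
have mG n : measurable_fun (circ `\` N) (G n).
  exact: measurable_funS (measurable_gap _ _).
have G0 n w : (circ `\` N) w -> 0 <= G n w by move=> _; apply: gap_ge0; exact: ltW.
have /le_trans := fatou mu mcN mG G0; apply.
have -> : (fun n => \int[mu]_(w in circ `\` N) G n w) = cst (ln 4 * (2 * pi))%:E.
  by apply/funext => n; rewrite /G -gapN ?ltW// gap_lt1.
by rewrite (cvg_limn_einf_sup (cvg_cst _)).1.
Qed.

End jensen.

(** * Arbitrary roots, and the mean of ln |G| *)

Section jensen_formula.
Context {R : realType}.
Local Notation mu := (@lebesgue_measure R).
Local Notation pi := (@pi R).
Local Notation toC := (@real_complex R).
Implicit Types x y w : R.

Lemma integral_ln_dist2_le1 x y : (x ^+ 2 + y ^+ 2 <= 1)%R ->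
  mu.-integrable circ (EFin \o (@ln R \o dist2 x y)) /\
  (\int[mu]_(w in circ) (ln (dist2 x y w))%:E = 0)%E.
Proof.
move=> xy1; have mc := @measurable_circ R.
have I : (\int[mu]_(w in circ) gap x y w = (ln 4 * (2 * pi))%:E)%E.
  by move: xy1; rewrite le_eqVlt => /predU1P[/gap_eq1|/gap_lt1].
have ig : mu.-integrable circ (gap x y).
  apply/integrableP; split; first exact: measurable_funS (measurable_gap _ _).
  under eq_integral do rewrite gee0_abs ?gap_ge0//.
  by rewrite I ltry.
have ic : mu.-integrable circ (cst (ln 4)%:E).
  apply/integrableP; split => //; under eq_integral do rewrite /cst/=.
  by rewrite integral_circ_cst ltry.
have E : EFin \o (@ln R \o dist2 x y) = (fun w => cst (ln 4)%:E w - gap x y w)%E.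
  by apply/funext => w; rewrite /= /gap -EFinB; congr EFin; ring.
have -> : (\int[mu]_(w in circ) (ln (dist2 x y w))%:E =
    \int[mu]_(w in circ) (EFin \o (@ln R \o dist2 x y)) w)%E by [].
rewrite E; split; first exact: integrableB.
by rewrite integralB// I integral_circ_cst -EFinB subrr.
Qed.

Lemma integral_ln_dist2 x y :
  mu.-integrable circ (EFin \o (@ln R \o dist2 x y)) /\
  (\int[mu]_(w in circ) (ln (dist2 x y w))%:E =
     (ln (Num.max 1 (x ^+ 2 + y ^+ 2)) * (2 * pi))%:E)%E.
Proof.
have mc := @measurable_circ R.
have [xy1|q1] := leP (x ^+ 2 + y ^+ 2) 1.
  by rewrite ln1 mul0r; exact: integral_ln_dist2_le1.
set q := x ^+ 2 + y ^+ 2 in q1 *.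
(* Outside the disc, (x + iy) / q is the inverse of the conjugate of a = x + iy, and |e^{iw} - a|^2
   = q |e^{iw} - 1/conj(a)|^2. *)
have q0 : 0 < q by apply: lt_trans q1.
have xyq : (x / q) ^+ 2 + (y / q) ^+ 2 = q^-1.
  by rewrite !exprMn -mulrDl -/q; field; rewrite gt_eqF.
have xyq1 : (x / q) ^+ 2 + (y / q) ^+ 2 < 1 by rewrite xyq invf_lt1.
have [ii Ii] := integral_ln_dist2_le1 (ltW xyq1).
have dE w : dist2 x y w = q * dist2 (x / q) (y / q) w.
  by rewrite !dist2E xyq -/q; field; rewrite gt_eqF.
have d0 w : 0 < dist2 (x / q) (y / q) w.
  pose r := Num.sqrt q^-1.
  have r0 : 0 <= r by exact: sqrtr_ge0.
  have rE : q^-1 = r ^+ 2 by rewrite sqr_sqrtr// invr_ge0 ltW.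
  have r1 : r < 1 by rewrite -(@ltr_pXn2r _ 2)// ?nnegrE// expr1n -rE -xyq.
  have [+ _] := dist2_bounds w r0 (etrans xyq rE); apply: lt_le_trans.
  by rewrite exprn_gt0// subr_gt0.
have ic : mu.-integrable circ (cst (ln q)%:E).
  apply/integrableP; split => //; under eq_integral do rewrite /cst/=.
  by rewrite integral_circ_cst ltry.
have E : EFin \o (@ln R \o dist2 x y) =
    (fun w => cst (ln q)%:E w + (EFin \o (@ln R \o dist2 (x / q)%R (y / q)%R)) w)%E.
  by apply/funext => w; rewrite /= dE lnM ?posrE.
have -> : (\int[mu]_(w in circ) (ln (dist2 x y w))%:E =
    \int[mu]_(w in circ) (EFin \o (@ln R \o dist2 x y)) w)%E by [].
rewrite E; split; first exact: integrableD.
by rewrite integralD//= Ii integral_circ_cst adde0.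
Qed.

Lemma sqr_cmod (z : R[i]) : cmod z ^+ 2 = complex.Re z ^+ 2 + complex.Im z ^+ 2.
Proof.
case: z => a b; rewrite /cmod normc_def/= sqr_sqrtr//.
by rewrite addr_ge0// sqr_ge0.
Qed.

Lemma cmod_ge0 (z : R[i]) : 0 <= cmod z.
Proof. by rewrite -lecR cmodE; exact: normr_ge0. Qed.

Lemma cmodM (z t : R[i]) : cmod (z * t) = cmod z * cmod t.
Proof. by apply: (@complexI R); rewrite rmorphM/= !cmodE normrM. Qed.

Definition cis w : R[i] := (cos w +i* sin w)%C.

Lemma cisX w k : cis w ^+ k = cis (k%:R * w).
Proof.
elim: k => [|k IH]; first by rewrite expr0 mul0r /cis cos0 sin0.
rewrite exprS IH /cis -natr1 mulrDl mul1r addrC cosD sinD.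
by apply/eqP; rewrite eq_complex/=; apply/andP; split; apply/eqP; ring.
Qed.

Lemma Gmag_cmod (g : nat -> R) eta w : Gmag g eta w = cmod (gpoly g eta).[cis w].
Proof.
rewrite -[RHS]ger0_norm ?cmod_ge0// -sqrtr_sqr sqr_cmod /Gmag.
have E : (gpoly g eta).[cis w] =
    ((\sum_(k < eta.+1) g k * cos (k%:R * w)) +i* (\sum_(k < eta.+1) g k * sin (k%:R * w)))%C.
  rewrite horner_poly.
  elim: eta.+1 => [|m IH]; first by rewrite !big_ord0.
  rewrite !big_ord_recr/= IH cisX.
  by apply/eqP; rewrite eq_complex/=; apply/andP; split; apply/eqP; ring.
by rewrite E.
Qed.

Lemma cmod_cis_sub (a : R[i]) w : cmod (cis w - a) ^+ 2 = dist2 (complex.Re a) (complex.Im a) w.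
Proof. by rewrite sqr_cmod; case: a. Qed.

Lemma ln_prod_seq (I : Type) (s : seq I) (F : I -> R) : (forall a, 0 < F a) ->
  ln (\prod_(a <- s) F a) = \sum_(a <- s) ln (F a).
Proof.
move=> F0; elim: s => [|a s IH]; first by rewrite !big_nil ln1.
by rewrite !big_cons lnM ?IH ?posrE ?prodr_gt0 ?F0//.
Qed.

Lemma ae_all_dist2_gt0 (s : seq R[i]) :
  {ae mu, forall w, circ w -> forall a, a \in s -> 0 < dist2 (complex.Re a) (complex.Im a) w}.
Proof.
elim: s => [|a s IH]; first exact: aeW.
apply: (filterS2 (ae_filter_ringOfSetsType mu) _
  (ae_dist2_gt0 (complex.Re a) (complex.Im a)) IH).
by move=> w da ds cw b; rewrite inE => /predU1P[->|bs]; [exact: da|exact: ds].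
Qed.

Lemma ln_max1_sqr_cmod (a : R[i]) :
  ln (Num.max 1 (complex.Re a ^+ 2 + complex.Im a ^+ 2)) = 2 * ln (Num.max 1 (cmod a)).
Proof.
rewrite -sqr_cmod; have [a1|a1] := leP (cmod a) 1.
  by rewrite max_l ?exprn_ile1 ?cmod_ge0// ln1 mulr0.
by rewrite max_r ?exprn_ege1 ?ltW// lnXn ?(lt_trans ltr01)// mulr_natl.
Qed.

Lemma jensen_Gmag (g : nat -> R) eta c (s : seq R[i]) :
  c != 0 -> gpoly g eta = c *: \prod_(a <- s) ('X - a%:P) ->
  (\int[mu]_(w in `[(- pi)%R, pi]) (ln (Gmag g eta w))%:E =
   (ln (mahler c s) * (2 * pi))%:E)%E.
Proof.
move=> c0 gE; have mc := @measurable_circ R.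
have cc0 : 0 < cmod c by rewrite -ltcR cmodE normr_gt0.
have GE w : Gmag g eta w ^+ 2 =
    cmod c ^+ 2 * \prod_(a <- s) dist2 (complex.Re a) (complex.Im a) w.
  rewrite Gmag_cmod gE hornerZ cmodM exprMn; congr (_ * _).
  rewrite horner_prod; elim: s {gE} => [|a s IH].
    by rewrite !big_nil -[1]/(toC 1) sqr_cmod/= expr1n expr0n addr0.
  by rewrite !big_cons cmodM exprMn IH !hornerE cmod_cis_sub.
have G0 w : 0 <= Gmag g eta w by exact: sqrtr_ge0.
have mG : measurable_fun setT (Gmag g eta).
  rewrite (_ : Gmag g eta = Num.sqrt \o (fun w => cmod c ^+ 2 *
    \prod_(a <- s) dist2 (complex.Re a) (complex.Im a) w)); last first.
    by apply/funext => w /=; rewrite -GE sqrtr_sqr ger0_norm.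
  apply: measurableT_comp.
    by apply: continuous_measurable_fun; exact: sqrt_continuous.
  apply: measurable_funM => //; apply: measurable_prod => a _; exact: measurable_dist2.
have mlG : measurable_fun setT (fun w => (ln (Gmag g eta w))%:E).
  by apply/measurable_EFinP; exact: (measurableT_comp (@measurable_ln R) mG).
(* The endpoint - pi is dropped to reach [circ]. *)
rewrite -integral_itv_obnd_cbnd; last exact: measurable_funS mlG.
rewrite -/circ.
pose H w : \bar R := ((ln (cmod c))%:E + 2^-1%:E *
   \sum_(a <- s) (EFin \o (@ln R \o dist2 (complex.Re a) (complex.Im a))) w)%E.
have isum : mu.-integrable circ
   (fun w => \sum_(a <- s) (EFin \o (@ln R \o dist2 (complex.Re a) (complex.Im a))) w)%E.
  by apply: integrable_sum => // a _; exact: (integral_ln_dist2 _ _).1.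
have ic : mu.-integrable circ (cst (ln (cmod c))%:E).
  apply/integrableP; split => //; under eq_integral do rewrite /cst/=.
  by rewrite integral_circ_cst ltry.
have -> : (\int[mu]_(w in circ) (ln (Gmag g eta w))%:E = \int[mu]_(w in circ) H w)%E.
  apply: ae_eq_integral => //.
  - exact: measurable_funS mlG.
  - apply: emeasurable_funD => //; apply: emeasurable_funM => //.
    exact: measurable_int isum.
  have := ae_all_dist2_gt0 s; apply: (@filterS _ _ (ae_filter_ringOfSetsType mu)) => w ds cw.
  have {}ds := ds cw.
  (* Setting the distance to 1 off the list of roots makes [d] positive everywhere, as [ln_prod_seq]
     demands. *)
  pose d (a : R[i]) := if a \in s then dist2 (complex.Re a) (complex.Im a) w else 1.
  have d0 a : 0 < d a by rewrite /d; case: ifPn => // /ds.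
  have dE (f : R -> R) a : a \in s ->
    f (d a) = f (dist2 (complex.Re a) (complex.Im a) w).
    by move=> as_; rewrite /d as_.
  have G2 : Gmag g eta w ^+ 2 = cmod c ^+ 2 * \prod_(a <- s) d a.
    rewrite GE; congr (_ * _); rewrite !big_seq; apply: eq_bigr => a as_.
    by rewrite (dE id).
  have Gw : 0 < Gmag g eta w.
    rewrite lt_def G0 andbT -sqrf_eq0 G2 gt_eqF// mulr_gt0 ?exprn_gt0//.
    by rewrite prodr_gt0.
  have := congr1 (@ln R) G2.
  rewrite lnM ?posrE ?exprn_gt0 ?prodr_gt0// !lnXn// ln_prod_seq// !mulr2n => lE.
  rewrite /H sumEFin -EFinM -EFinD; congr EFin.
  have <- : \sum_(a <- s) ln (d a) =
      \sum_(a <- s) (@ln R \o dist2 (complex.Re a) (complex.Im a)) w.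
    by rewrite !big_seq; apply: eq_bigr => a as_; rewrite (dE (@ln R)).
  by move: lE; lra.
rewrite /H integralD//; last exact: integrableZl.
rewrite integralZl// integral_sum//; last by move=> a; exact: (integral_ln_dist2 _ _).1.
rewrite integral_circ_cst.
under eq_bigr do rewrite (integral_ln_dist2 _ _).2 ln_max1_sqr_cmod.
rewrite sumEFin -EFinM -EFinD; congr EFin.
rewrite /mahler lnM ?posrE//; last by apply: prodr_gt0 => a _; rewrite lt_max ltr01.
rewrite ln_prod_seq => [|a]; last by rewrite lt_max ltr01.
by rewrite -mulr_suml -mulr_sumr; field.
Qed.
End jensen_formula.

(** * Entropy gain *)

(** Whichever decomposition is chosen, A S = T C is square and invertible, and its determinant
    squared is det (S^T S). *)
Lemma eff_entropyE (R : realType) (d : measure_display) (T : measurableType d)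
    (P : probability T R) (l n : nat) (S : 'M[R]_(l, n)) (X : T -> 'cV[R]_n) :
  0 < \det (S^T *m S) -> diff_entropy P X \is a fin_num ->
  eff_entropy P S (fun w => S *m X w) =
    (diff_entropy P X + (ln (\det (S^T *m S)) / 2)%:E)%E.
Proof.
move=> dS hX; rewrite /eff_entropy; case: pselect => [H|noSVD]; last first.
  have [A [Tm [C svd]]] := thin_svd_exists (lt0r_neq0 dS).
  by case: noSVD; exists (A, Tm, C).
case: (cid H) => -[[A Tm] C]/= [SE AA _ _ _].
have AS w : A *m (S *m X w) = Tm *m C *m X w.
  by rewrite SE !mulmxA AA mul1mx.
under eq_fun do rewrite AS.
have dTC := det_thin_svd SE AA.
have uTC : Tm *m C \in unitmx.
  by rewrite unitmxE unitfE -sqrf_eq0 dTC gt_eqF.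
rewrite diff_entropy_linear//; congr (_ + _%:E)%E.
have nTC : 0 < `|\det (Tm *m C)| by rewrite normr_gt0 -unitfE -unitmxE.
have -> : ln (\det (S^T *m S)) = ln `|\det (Tm *m C)| *+ 2.
  by rewrite -lnXn// real_normK ?num_real// dTC.
by rewrite mulr2n; lra.
Qed.

(** * From determinant bounds to the exponential rate *)

Section growth.
Context {R : realType}.

Lemma ln_le_sqrt (x : R) : 0 < x -> ln x <= 2 * Num.sqrt x.
Proof.
move=> x0; have s0 : 0 < Num.sqrt x by rewrite sqrtr_gt0.
rewrite -[in leLHS](sqr_sqrtr (ltW x0)) lnXn//.
by have := ln_sublinear s0; rewrite [ln _ *+ 2]mulr2n; lra.
Qed.

Lemma cvg_invn : (n%:R^-1 : R) @[n --> \oo] --> (0 : R).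
Proof.
apply/cvgrPdist_lt => e e0; near=> n.
rewrite sub0r normrN ger0_norm ?invr_ge0//.
rewrite invf_plt ?posrE ?ltr0n//; last by near: n; exists 1%N.
by near: n; exact: nbhs_infty_gtr.
Unshelve. all: by end_near. Qed.

Lemma ln_growth_cvg (M K : R) (e : nat) (D : nat -> R) : 0 < M -> 0 <= K ->
  (forall n, (0 < n)%N -> M ^+ (2 * n) <= D n /\ D n <= M ^+ (2 * n) * (K * n%:R ^+ e)) ->
  (ln (D n) / 2 / n%:R) @[n --> \oo] --> ln M.
Proof.
move=> M0 K0 HD.
(* The two bounds at n = 1 exclude K = 0, so [lnM] may split off ln K below. *)
have K_gt0 : 0 < K.
  have [h1 /(le_trans h1)] := HD 1%N isT; rewrite expr1n mulr1 => h.
  rewrite lt_def K0 andbT; apply: contraTneq h => ->.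
  by rewrite mulr0 -ltNge exprn_gt0.
have M2 n : 0 < M ^+ (2 * n) by exact: exprn_gt0.
(* The bound ln n <= 2 sqrt n turns e ln n / (2 n) into e / sqrt n, whose limit needs only
   continuity of the square root. *)
pose b n : R := ln M + (`|ln K| * n%:R^-1 + e%:R * Num.sqrt (n%:R^-1)).
apply: (@squeeze_cvgr _ _ _ _ (cst (ln M)) b).
- near=> n.
  have n0 : (0 < n)%N by near: n; exists 1%N.
  have n0R : 0 < n%:R :> R by rewrite ltr0n.
  have [h1 h2] := HD n n0.
  have D0 : 0 < D n by exact: lt_le_trans h1.
  have l1 : ln M *+ (2 * n) <= ln (D n) by rewrite -lnXn// ler_ln// posrE.
  have l2 : ln (D n) <= ln M *+ (2 * n) + (ln K + ln n%:R *+ e).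
    rewrite -!lnXn// -lnM ?posrE ?exprn_gt0// -lnM ?posrE ?mulr_gt0 ?exprn_gt0//.
    by rewrite ler_ln// posrE ?mulr_gt0 ?exprn_gt0.
  move: l1 l2; rewrite -(mulr_natl (ln M)) -(mulr_natl (ln n%:R)) natrM => l1 l2.
  apply/andP; split.
    by rewrite /cst !ler_pdivlMr//; lra.
  rewrite !ler_pdivrMr// /b; have := ln_le_sqrt n0R; set sq := Num.sqrt n%:R => lsq.
  have sE : Num.sqrt (n%:R^-1) * n%:R = sq.
    rewrite sqrtrV// -/sq -[X in _ * X](sqr_sqrtr (ltW n0R)) -/sq expr2 mulrA.
    by rewrite mulVf ?mul1r// gt_eqF// sqrtr_gt0.
  apply: le_trans l2 _; rewrite !mulrDl.
  have -> : `|ln K| / n%:R * n%:R = `|ln K| by rewrite mulfVK// gt_eqF.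
  rewrite -(mulrA e%:R) sE.
  have lK := ler_norm (ln K).
  have : e%:R * ln n%:R <= e%:R * (2 * sq) by rewrite ler_wpM2l.
  have nK := normr_ge0 (ln K).
  by lra.
- exact: cvg_cst.
- rewrite -[X in _ --> X]addr0; apply: cvgD; first exact: cvg_cst.
  rewrite -[X in _ --> X]addr0; apply: cvgD.
    by rewrite -[X in _ --> X](mulr0 `|ln K|); apply: cvgM; [exact: cvg_cst|exact: cvg_invn].
  rewrite -[X in _ --> X](mulr0 e%:R); apply: cvgM; first exact: cvg_cst.
  rewrite -[X in _ --> X]sqrtr0.
  apply: (cvg_comp _ _ cvg_invn); exact: sqrt_continuous.
Unshelve. all: by end_near. Qed.
End growth.

Theorem mainTheorem14 (R : realType) (d : measure_display) (T : measurableType d)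
  (P : probability T R) (u : nat -> T -> R) (eta : nat) (g : nat -> R) :
  (forall k, measurable_fun setT (u k)) ->
  entropy_balanced P u ->
  (forall n, diff_entropy P (vecn u n) \is a fin_num) ->
  (exists k, (k <= eta)%N /\ g k != 0) ->
  (fun n : nat =>
     ((eff_entropy P (Gmat g eta n) (fun w => Gmat g eta n *m vecn u n w)
       - diff_entropy P (vecn u n)) * (n%:R^-1)%:E)%E) @ \oo -->
  (((2 * pi)^-1)%:E *
     \int[@lebesgue_measure R]_(w in `[(- pi)%R, pi%R]) (ln (Gmag g eta w))%:E)%E.
Proof.
move=> _ _ hfin [k [keta gk]].
have g0 : gpoly g eta != 0.
  apply/eqP => /polyP/(_ k); rewrite coef_poly ltnS keta coef0.
  by move=> /(@complexI R _ 0) gk0; rewrite gk0 eqxx in gk.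
have [s gE] := closed_field_poly_normal (gpoly g eta).
set c := lead_coef _ in gE; have c0 : c != 0 by rewrite lead_coef_eq0.
have [K [e [K0 HD]]] := det_Gmat_bounds c0 gE.
have M0 := mahler_gt0 s c0.
have pi0 := @pi_gt0 R.
rewrite (jensen_Gmag c0 gE) -EFinM.
have -> : (2 * pi)^-1 * (ln (mahler c s) * (2 * pi)) = ln (mahler c s).
  by rewrite mulrCA mulVf ?mulr1// gt_eqF// mulr_gt0.
(* For n > 0 the determinant is positive and the finite entropy of the input cancels; only the
   logarithm of the Gram determinant is left. *)
apply: (@cvg_trans _
  ((ln (\det ((Gmat g eta n)^T *m Gmat g eta n)) / 2 / n%:R)%:E @[n --> \oo])).
  apply: near_eq_cvg; near=> n.
  have n0 : (0 < n)%N by near: n; exists 1%N.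
  have [h1 _] := HD n n0.
  rewrite eff_entropyE//; last by apply: lt_le_trans h1; rewrite exprn_gt0.
  by rewrite addeAC subee ?hfin// add0e -EFinM.
apply: cvg_EFin; first exact: nearW.
exact: ln_growth_cvg M0 K0 HD.
Unshelve. all: by end_near. Qed.
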